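(* Let $k = k(n)$ satisfy $k = \omega\left( \frac{n}{\log^{1/3} n} \right)$, let $G$ be a $k$-regular bipartite graph on $2n$ vertices, and let $\tilde{G}$ be a uniformly random graph process in $G$. Then, asymptotically almost surely, $\tau_M(\tilde{G}) = \tau_I(\tilde{G})$.
   Context: A graph process in $G=(V,E)$ is a sequence of graphs $(V,\emptyset)=G_0,G_1,\ldots,G_{|E|}=G$ on vertex set $V$ where each $G_i$ is obtained from $G_{i-1}$ by adding a single edge of $G$; a uniformly random graph process corresponds to a uniformly random ordering of $E$. For a monotone graph property $P$, the hitting time of $P$ is $\min\{t : G_t \in P\}$. $\tau_M(\tilde G)$ is the hitting time of containing a perfect matching and $\tau_I(\tilde G)$ is the hitting time of having no isolated vertices. ''Asymptotically almost surely'' (a.a.s.) means with probability tending to $1$ as $n\to\infty$. $\log$ denotes the natural logarithm. *)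

(* Defs.v *)
From Stdlib Require Import Reals.
From mathcomp Require Import all_boot.
Set Implicit Arguments. Unset Strict Implicit. Unset Printing Implicit Defensive.

Section Graphs.
Variable T : finType.

Definition simple_graph (e : rel T) : Prop :=
  (forall x y, e x y = e y x) /\ (forall x, ~~ e x x).

Definition bipartite (e : rel T) : Prop :=
  exists c : T -> bool, forall x y, e x y -> c x != c y.

Definition regular (k : nat) (e : rel T) : Prop :=
  forall x, #|[set y | e x y]| = k.

Definition edges (e : rel T) : {set {set T}} :=
  [set S : {set T} | [exists x, exists y, e x y && (S == [set x; y])]].

Definition has_perfect_matching (F : seq {set T}) : bool :=
  [exists M : {set {set T}},
     [forall S in M, S \in F] &&
     [forall v : T, #|[set S in M | v \in S]| == 1]].

Definition no_isolated (F : seq {set T}) : bool :=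
  [forall v : T, has (fun S : {set T} => v \in S) F].

Definition hitting_time (P : seq {set T} -> bool) (s : seq {set T}) : nat :=
  find (fun t => P (take t s)) (iota 0 (size s).+1).

(* all orderings of E (each exactly once): the uniformly random graph process *)
Definition processes (e : rel T) : seq (seq {set T}) :=
  permutations (enum (edges e)).

Definition prob_tauM_eq_tauI (e : rel T) : R :=
  Rdiv (INR (count (fun s => hitting_time has_perfect_matching s
                         == hitting_time no_isolated s) (processes e)))
       (INR (size (processes e))).
End Graphs.

(* Main.v *)
(**
Colour every edge independently 0, 1 or 2 and let [H0] be the edges of colour 0 and [H1] those
of colour at most 1, where an edge lies in [H0] with probability [0.9 log n / k] and in [H1]
with probability [2 log n / k].  Ordering the edges by colour, and uniformly within each colour,
gives the random graph process; with high probability [H0] has an isolated vertex and [H1] has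
none, so the graph [F] at time [tau_I] satisfies [H0 <= F <= H1].

By Hall's theorem a missing perfect matching gives an [F]-independent set [W] with more than [n]
vertices.  Call an edge monochromatic if [W] contains both or none of its ends.  [W] spans an
edge set avoided by [H0], which forces [W] to have few monochromatic edges in the whole graph.
Flip the set of vertices almost all of whose edges are monochromatic; this gives a tame cut [W1].
Sets [W] with few monochromatic edges are determined, up to vertices with many such edges, by
their trace on a small sample of vertices, so tame cuts are few and Chernoff bounds hold
for all of them at once.  A flipped vertex of large [H0]-degree would have many edges to other
flipped vertices, so there are few of them; a flipped vertex of low [H0]-degree is matched
injectively with an [F]-neighbour that was flipped the other way, since vertices of low degree
are far apart and far from monochromatic edges.  Hence [W1] still has more than about [n]
vertices, thus spans many edges of the graph and of [H0], whereas the edges of [H0] inside [W1]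
all touch the few flipped vertices: a contradiction.
*)

Require Import Defs.
From Stdlib Require Import Reals.
From mathcomp Require Import all_boot all_order all_algebra all_fingroup archimedean.
From mathcomp Require Import reals sequences exp.
From mathcomp Require Import lra ring zify.
Set Implicit Arguments. Unset Strict Implicit. Unset Printing Implicit Defensive.

(** * Finite sets and Hall's theorem *)

(** A cut of level [j] has about [j * k] monochromatic edges, of which [H0] is expected to contain
    only about [j * log n]; a Chernoff bound for it fails with probability [n ^ (- O(j))] and no
    less. A union bound over cuts must stay within that budget. Flipping single vertices of one
    clean cut already gives about [n] cuts per unit of level, which is too many; hence the passage
    to tame cuts, of which there are only [exp (O(j))] per level, up to a factor [n ^ (1 / 100)] for
    the samples. The flipped sets do not fit into this budget and get a union bound of their own:
    each flipped vertex costs a factor [n], and an exponential moment with parameter 1200 returns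
    about six such factors. This fixes [E], which must beat [exp 1200] to make the edges concerned
    rare. The low-degree threshold [log n / 50] lies above that deviation bound, yet low enough to
    leave only about [n ^ (1 / 4)] vertices below it. The graph at time [tau_I] depends on the whole
    ordering, so every random event is phrased through [H0] and [H1] alone. *)

Lemma leq_cardU (T : finType) (A B C : {set T}) : A \subset B :|: C -> #|A| <= #|B| + #|C|.
Proof.
by move=> /subset_leq_card h; apply: (leq_trans h); rewrite cardsU leq_subr.
Qed.

Lemma card_bigcup_le (I T : finType) (P : pred I) (F : I -> {set T}) :
  (#|\bigcup_(i | P i) F i| <= \sum_(i | P i) #|F i|).
Proof.
apply: (big_ind2 (fun (A : {set T}) n => #|A| <= n)) => //; first by rewrite cards0.
by move=> A a B b Aa Bb; apply: (leq_trans (leq_cardU (subxx _))); exact: leq_add.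
Qed.

Lemma card_pairs (T : finType) (A : {set T}) (D : T -> {set T}) :
  #|[set x : T * T | (x.1 \in A) && (x.2 \in D x.1)]| = (\sum_(v in A) #|D v|).
Proof.
rewrite -sum1_card (eq_bigl (fun x : T * T => (x.1 \in A) && (x.2 \in D x.1))); last first.
  by move=> x; rewrite in_set.
rewrite -(pair_big_dep (mem A) (fun v w => w \in D v) (fun _ _ => 1)) /=.
by apply: eq_bigr => v _; rewrite sum1_card.
Qed.

(** An edge with exactly one end in [A] remembers its orientation, so no unordered pair arises
    twice. *)
Lemma card_edges (T : finType) (A : {set T}) (D : T -> {set T}) :
  (forall v w, v \in A -> w \in D v -> w \notin A) ->
  #|[set [set v; w] | v in A, w in D v]| = (\sum_(v in A) #|D v|).
Proof.
move=> AD; rewrite -card_pairs -(card_in_imset (f := fun x : T * T => [set x.1; x.2])).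
  apply: eq_card => S; apply/imset2P/imsetP => [[v w vA wD ->]|[[v w]]].
    by exists (v, w); rewrite // in_set vA.
  by rewrite in_set /= => /andP[vA wD] ->; exists v w.
move=> [v w] [v' w']; rewrite !in_set /= => /andP[vA wD] /andP[v'A w'D] eS.
have vv' : v = v'.
  have : v \in [set v'; w'] by rewrite -eS set21.
  by rewrite !inE => /orP[/eqP//|/eqP ev]; have := AD _ _ v'A w'D; rewrite -ev vA.
have : w \in [set v'; w'] by rewrite -eS set22.
rewrite !inE => /orP[/eqP ew|/eqP->]; last by rewrite vv'.
by have := AD _ _ vA wD; rewrite ew v'A.
Qed.

Lemma card_edges_le (T : finType) (A : {set T}) (D : T -> {set T}) :
  (#|[set [set v; w] | v in A, w in D v]| <= \sum_(v in A) #|D v|).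
Proof.
rewrite -card_pairs.
apply: leq_trans (leq_imset_card (fun x : T * T => [set x.1; x.2]) _).
apply/subset_leq_card/subsetP => S /imset2P[v w vA wD ->].
by apply/imsetP; exists (v, w); rewrite // in_set vA.
Qed.

Lemma card_star (T : finType) v (D : {set T}) : v \notin D ->
  #|[set [set v; w] | w in D]| = #|D|.
Proof.
move=> vD; rewrite card_in_imset // => w w' wD w'D /setP/(_ w).
rewrite !inE eqxx orbT => /esym/orP[/eqP ew|/eqP//].
by move: vD; rewrite -ew wD.
Qed.

Section Hall.
Variables (T : finType).

Definition nbr_set (f : rel T) (S : {set T}) : {set T} := [set y | [exists x in S, f x y]].

Lemma nbr_setP (f : rel T) (S : {set T}) y : reflect (exists2 x, x \in S & f x y) (y \in nbr_set f S).
Proof. by rewrite inE; exact: exists_inP. Qed.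

Lemma nbr_setU f (S S' : {set T}) : nbr_set f (S :|: S') = nbr_set f S :|: nbr_set f S'.
Proof.
apply/setP => y; rewrite in_setU; apply/nbr_setP/orP => [[x]|].
  by rewrite inE => /orP[] xS xy; [left|right]; apply/nbr_setP; exists x.
by case=> /nbr_setP[x xS xy]; exists x; rewrite // inE xS ?orbT.
Qed.

(** Induction on [#|A|]. A proper nonempty tight set is matched on its own and its neighbours are
    deleted; if there is none, every such set has a spare neighbour, so one vertex can be matched
    arbitrarily. *)
Theorem hall (A : {set T}) (f : rel T) :
  (forall S : {set T}, S \subset A -> #|S| <= #|nbr_set f S|) ->
  exists2 g : T -> T, {in A &, injective g} & {in A, forall x, f x (g x)}.
Proof.
have [N] := ubnP #|A|; elim: N => // N IH in A f * => leN hall.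
have [->|[a aA]] := set_0Vmem A; first by exists id => x; rewrite inE.
have [/existsP[S /and4P[SA S0 SnA tight]]|] :=
  boolP [exists S : {set T}, [&& S \subset A, S != set0, S != A & #|nbr_set f S| == #|S|]].
- have SltA : #|S| < #|A| by rewrite proper_card // properEneq SnA.
  have [|S' SS'|g1 inj1 f1] := IH S f; first by apply: (leq_trans SltA).
    by apply: hall; apply: subset_trans SA.
  pose f' x y := f x y && (y \notin nbr_set f S).
  have [|S' SS'|g2 inj2 f2] := IH (A :\: S) f'.
  + have := cardsID S A; rewrite (setIidPr SA); have : 0 < #|S| by rewrite card_gt0.
    move: leN; lia.
  + have dSS : [disjoint S & S'].
      rewrite disjoint_sym disjoint_subset; apply/subsetP => x /(subsetP SS').
      by rewrite !inE => /andP[].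
    (* Hall's condition for [S :|: S'], minus the equality for the tight set [S], is the condition
       for [S'] in [f']. *)
    have h := hall (S :|: S'); rewrite subUset SA (subset_trans SS' (subsetDl _ _)) in h.
    have {}h := h isT; rewrite cardsU disjoint_setI0 // cards0 subn0 nbr_setU in h.
    have sub : nbr_set f S :|: nbr_set f S' \subset nbr_set f S :|: nbr_set f' S'.
      apply/subsetP => y; rewrite !in_setU; case: (boolP (y \in nbr_set f S)) => //= yS.
      by move=> /nbr_setP[x xS' xy]; apply/nbr_setP; exists x; rewrite // /f' xy.
    have := leq_trans (subset_leq_card sub) (leq_cardU (subxx _)).
    by move/eqP: tight h; lia.
  exists (fun x => if x \in S then g1 x else g2 x).
    move=> x y xA yA; case: ifP => xS; case: ifP => yS.
    + exact: inj1.
    + move=> e12; have := f2 y; rewrite inE yS yA => /(_ isT)/andP[_]; rewrite -e12.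
      by move/negP; case; apply/nbr_setP; exists x => //; exact: f1.
    + move=> e12; have := f2 x; rewrite inE xS xA => /(_ isT)/andP[_]; rewrite e12.
      by move/negP; case; apply/nbr_setP; exists y => //; exact: f1.
    + by apply: inj2; rewrite inE ?xS ?yS.
  move=> x xA; case: ifP => xS; first exact: f1.
  by have := f2 x; rewrite inE xS xA => /(_ isT)/andP[].
rewrite negb_exists => /forallP strict.
have [b] : exists b, b \in nbr_set f [set a].
  by apply/set0Pn; rewrite -card_gt0; have := hall [set a]; rewrite sub1set aA cards1 => /(_ isT).
move=> /nbr_setP[a' /set1P -> ab].
pose f' x y := f x y && (y != b).
have [|S SA|g inj fg] := IH (A :\ a) f'.
- by have := cardsD1 a A; rewrite aA; move: leN; lia.
- have [->|S0] := eqVneq S set0; first by rewrite cards0.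
  have SA' : S \subset A by apply: subset_trans SA (subsetDl _ _).
  have SnA : S != A by apply/eqP => eSA; have := subsetP SA a; rewrite eSA !inE eqxx aA => /(_ isT).
  have lt : #|S| < #|nbr_set f S|.
    have := strict S; rewrite SA' S0 SnA /= => ne; rewrite ltn_neqAle eq_sym ne; exact: hall.
  have sub : nbr_set f S \subset [set b] :|: nbr_set f' S.
    apply/subsetP => y /nbr_setP[x xS xy]; rewrite in_setU in_set1; case: eqP => //= yb.
    by apply/nbr_setP; exists x; rewrite // /f' xy; apply/eqP.
  by have := leq_trans (subset_leq_card sub) (leq_cardU (subxx _)); rewrite cards1; lia.
exists (fun x => if x == a then b else g x).
  move=> x y xA yA; case: eqP => xa; case: eqP => ya; rewrite ?xa ?ya //.
  - by move=> e12; have := fg y; rewrite !inE yA (introF eqP ya) => /(_ isT)/andP[_]; rewrite e12 eqxx.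
  - by move=> e12; have := fg x; rewrite !inE xA (introF eqP xa) => /(_ isT)/andP[_]; rewrite e12 eqxx.
  - by apply: inj; rewrite !inE ?xA ?yA andbT; apply/eqP.
move=> x xA; case: eqP => [->//|/eqP xa].
by have := fg x; rewrite !inE xA xa => /(_ isT)/andP[].
Qed.
End Hall.

(** * Cuts with few monochromatic edges *)

Section Cuts.
Variables (T : finType) (e : rel T) (k : nat).
Hypotheses (k_gt0 : 0 < k) (e_sym : symmetric e) (e_reg : forall x, #|[set y | e x y]| = k).

Definition nb x : {set T} := [set y | e x y].
Definition nbs (Q : {set T}) : {set T} := \bigcup_(q in Q) nb q.
Definition mono_deg (W : {set T}) v := #|[set w in nb v | (w \in W) == (v \in W)]|.
(* Every monochromatic edge is counted twice. *)
Definition mono (W : {set T}) := \sum_v mono_deg W v.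
Definition flip (W F : {set T}) : {set T} := [set x | (x \in W) (+) (x \in F)].

Lemma card_nb x : #|nb x| = k. Proof. exact: e_reg. Qed.

(** Take [Q] of maximal size among the sets whose neighbourhood has at least half the largest
    conceivable size. A vertex with more than [k / 2] neighbours still uncovered could be added. *)
Lemma greedy (W : {set T}) : exists Q : {set T},
  [/\ Q \subset W, #|Q| * k <= 2 * #|T|
    & forall x, x \in W -> 2 * #|nb x :\: nbs Q| <= k].
Proof.
pose P (Q : {set T}) := (Q \subset W) && (#|Q| * k <= 2 * #|nbs Q|).
have P0 : P set0 by rewrite /P sub0set cards0.
have [Q /andP[QW Qk] Qmax] := @arg_maxnP _ set0 P (fun Q : {set T} => #|Q|) P0.
exists Q; split=> // [|x xW]; first by apply: (leq_trans Qk); rewrite leq_mul2l max_card orbT.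
rewrite leqNgt; apply/negP => xk.
have xQ : x \notin Q.
  apply: contraL xk => xQ; rewrite -leqNgt.
  suff -> : nb x :\: nbs Q = set0 by rewrite cards0.
  by apply/eqP; rewrite setD_eq0; exact: (bigcup_sup x).
have /Qmax : P (x |: Q).
  rewrite /P subUset sub1set xW QW cardsU1 xQ /=.
  have -> : nbs (x |: Q) = nbs Q :|: (nb x :\: nbs Q).
    rewrite /nbs big_setU1 //= setUC; apply/setP => y; rewrite !inE.
    by case: (y \in \bigcup_(_ in _) _); rewrite ?orbT.
  rewrite cardsU (_ : nbs Q :&: _ = set0) ?cards0; last first.
    by apply/setP => y; rewrite !inE; case: (y \in nbs Q).
  lia.
by rewrite cardsU1 xQ; lia.
Qed.

(** Each sample is chosen greedily outside the earlier ones. The price of disjointness is that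
    covering is only known for vertices outside all samples. *)
Lemma many_greedy M : exists Qs : nat -> {set T},
  [/\ forall i, #|Qs i| * k <= 2 * #|T|,
      forall i j, i < j -> j < M -> [disjoint Qs i & Qs j]
    & forall x i, i < M -> (forall j, j < M -> x \notin Qs j) ->
        2 * #|nb x :\: nbs (Qs i)| <= k].
Proof.
elim: M => [|M [Qs [Qk Qd Qc]]]; first by exists (fun=> set0); split=> // i; rewrite cards0.
have [Q [QW Qs' Qx]] := greedy (~: \bigcup_(j < M) Qs j).
exists (fun i => if i == M then Q else Qs i); split.
- by move=> i; case: ifP.
- move=> i j ij; rewrite ltnS leq_eqVlt => /orP[/eqP jM|jM].
    rewrite jM eqxx (_ : (i == M) = false); last by lia.
    rewrite disjoint_sym disjoint_subset; apply/subsetP => x /(subsetP QW).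
    rewrite !inE => /negP h; apply/negP => xi; apply: h.
    have iM : i < M by lia.
    by apply/bigcupP; exists (Ordinal iM).
  have -> : (i == M) = false by lia.
  have -> : (j == M) = false by lia.
  exact: Qd.
- move=> x i iM xQ; case: eqP => [_|ne].
    apply: Qx; rewrite inE; apply/negP => /bigcupP[j _ xj].
    by have := xQ j (ltnW (ltn_ord j)); rewrite (_ : (_ == M) = false) ?xj //; have := ltn_ord j; lia.
  apply: Qc; first by lia.
  by move=> j jM; have := xQ j (ltnW jM); rewrite (_ : (_ == M) = false) //; lia.
Qed.

Lemma card_mono_deg_ge (W : {set T}) a b :
  #|[set v | a * k <= b * mono_deg W v]| * (a * k) <= b * mono W.
Proof.
rewrite -sum_nat_const /mono big_distrr /= [leqRHS](bigID [pred v | a * k <= b * mono_deg W v]) /=.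
apply: (leq_trans _ (leq_addr _ _)).
by rewrite (eq_bigl [pred v | a * k <= b * mono_deg W v]) ?leq_sum // => v; rewrite inE.
Qed.

(** First vote. With [P] the part of the sample in [W], the vertices of [nbs P] are guessed to lie
    outside [W]. A typical member of [W] sees close to [k / 2] of them or more, a typical non-member
    almost none; [k / 4] separates the two cases. *)
Definition decode1 (P : {set T}) : {set T} := [set x | k <= 4 * #|nb x :&: nbs P|].
Definition decode (P : {set T}) : {set T} := [set x | 2 * #|nb x :&: decode1 P| <= k].

(* [W] is recovered from its trace on the sample [Q] up to vertices with many monochromatic
   neighbours: read off the sides of [nbs Q], then vote twice. *)
Lemma decode_ok (Q W Out : {set T}) :
  (forall x, x \notin Out -> 2 * #|nb x :\: nbs Q| <= k) ->
  100 * (\sum_(q in Q) mono_deg W q) <= k ->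
  100 * (5 * mono W + #|Out| * k) <= k * k ->
  forall v, 100 * mono_deg W v < 49 * k -> (v \in decode (Q :&: W)) = (v \in W).
Proof.
move=> Qcov Qmono small.
pose P := Q :&: W.
(* Outside [Err], a vertex of [nbs Q] lies on the side opposite to each of its neighbours in the
   sample. *)
pose Err := \bigcup_(q in Q) [set y in nb q | (y \in W) == (q \in W)].
have cErr : 100 * #|Err| <= k.
  apply: (leq_trans _ Qmono); rewrite leq_mul2l /=.
  exact: card_bigcup_le.
have PW y : y \in nbs P -> y \in W -> y \in Err.
  move=> /bigcupP[q]; rewrite inE => /andP[qQ qW] yq yW.
  by apply/bigcupP; exists q => //; rewrite inE yq yW qW.
have QPW y : y \in nbs Q -> y \notin nbs P -> y \notin W -> y \in Err.
  move=> /bigcupP[q qQ yq] yP yW; apply/bigcupP; exists q => //.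
  rewrite inE yq (negbTE yW) /=; apply/eqP; symmetry; apply/negP => qW.
  by case/negP: yP; apply/bigcupP; exists q; rewrite // inE qQ.
have dec1 x : x \notin Out -> 5 * mono_deg W x < k -> (x \in decode1 P) = (x \in W).
  move=> xO xm; rewrite inE; case: (boolP (x \in W)) => xW.
    have := Qcov x xO; have := cardsID (nbs Q) (nb x); rewrite card_nb => s1 s2.
    have : #|nb x :&: nbs Q| <= #|nb x :&: nbs P| + #|[set w in nb x | (w \in W) == (x \in W)]| + #|Err|.
      rewrite -addnA; apply: (leq_trans _ (leq_add (leqnn _) (leq_cardU (subxx _)))).
      apply: leq_cardU; apply/subsetP => y; rewrite !in_setU !in_set xW => /andP[yx yQ].
      rewrite yx /=; case: (boolP (y \in nbs P)) => //= yP; case: (boolP (y \in W)) => //= yW.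
      exact: QPW.
    rewrite -/(mono_deg W x) => s3; apply/idP; lia.
  apply/negbTE; rewrite -ltnNge.
  have : #|nb x :&: nbs P| <= #|[set w in nb x | (w \in W) == (x \in W)]| + #|Err|.
    apply: leq_cardU; apply/subsetP => y; rewrite !in_setU !in_set (negbTE xW) => /andP[yx yP].
    by rewrite yx /=; case: (boolP (y \in W)) => //= yW; exact: PW.
  rewrite -/(mono_deg W x); lia.
(* The first vote can be wrong only on [Err2], at most [k / 100] vertices. The second vote therefore
   tolerates any monochromatic degree below [k / 2 - k / 100], also inside [Out]. *)
pose Err2 := [set x | 1 * k <= 5 * mono_deg W x] :|: Out.
have cErr2 : 100 * #|Err2| <= k.
  have := card_mono_deg_ge W 1 5; have := leq_cardU (subxx Err2); rewrite mul1n => s1 s2.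
  rewrite -(leq_pmul2r k_gt0); apply: (leq_trans _ small).
  rewrite -mulnA leq_mul2l /=.
  apply: (leq_trans (leq_mul s1 (leqnn k))).
  by rewrite mulnDl leq_add2r.
have agree y : y \notin Err2 -> (y \in decode1 P) = (y \in W).
  rewrite in_setU negb_or => /andP[]; rewrite in_set mul1n -ltnNge => y1 y2; exact: dec1.
move: (Err2) cErr2 agree => {}Err2 cErr2 agree v vm.
rewrite -/P inE; case: (boolP (v \in W)) => vW.
  have : #|nb v :&: decode1 P| <= #|[set w in nb v | (w \in W) == (v \in W)]| + #|Err2|.
    apply: leq_cardU; apply/subsetP => y; rewrite !in_setU !in_set vW => /andP[yv yd].
    case: (boolP (y \in Err2)) => yE; first by rewrite orbT.
    by rewrite -(agree y yE) inE yd yv.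
  rewrite -/(mono_deg W v); lia.
apply/negbTE; rewrite -ltnNge.
have : #|nb v| <= #|nb v :&: decode1 P| + #|[set w in nb v | (w \in W) == (v \in W)]| + #|Err2|.
  rewrite -addnA; apply: (leq_trans _ (leq_add (leqnn _) (leq_cardU (subxx _)))).
  apply: leq_cardU; apply/subsetP => y yv.
  rewrite in_setU in_setI in_setU yv /=; case: (boolP (y \in Err2)) => yE; first by rewrite !orbT.
  by rewrite (agree y yE) orbF in_set yv (negbTE vW) /=; case: (y \in W).
rewrite -/(mono_deg W v) card_nb; lia.
Qed.

Definition sample_size := 2 * #|T| %/ k.

(* The samples are disjoint, so by averaging one of them carries few monochromatic edges. *)
Lemma base_family M : exists fam : {set {set T}}, #|fam| <= M * 2 ^ sample_size /\ forall W : {set T}, 0 < M -> 100 * mono W <= M * k ->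
    100 * (5 * mono W + M * (2 * #|T|)) <= k * k ->
  exists2 B, B \in fam & forall v, 100 * mono_deg W v < 49 * k -> (v \in B) = (v \in W).
Proof.
have [Qs [Qk Qd Qc]] := many_greedy M.
pose Out := \bigcup_(i < M) Qs i.
exists (\bigcup_(i < M) [set decode P | P in powerset (Qs i)]); split.
  apply: (@leq_trans (\sum_(i < M) 2 ^ sample_size)); last by rewrite sum_nat_const card_ord.
  apply: (@leq_trans (\sum_(i < M) #|[set decode P | P in powerset (Qs i)]|)).
    exact: card_bigcup_le.
  apply: leq_sum => i _; apply: (leq_trans (leq_imset_card _ _)).
  by rewrite card_powerset leq_pexp2l // /sample_size leq_divRL.
move=> W M0 monoM small.
have [i ih] : exists i : 'I_M, 100 * (\sum_(q in Qs i) mono_deg W q) <= k.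
  apply/existsP; case: (boolP [exists _, _]) => //; rewrite negb_exists => /forallP h; exfalso.
  have s1 : \sum_(i < M) \sum_(q in Qs i) mono_deg W q <= mono W.
    rewrite /mono (exchange_big_dep xpredT) //= (eq_bigr (fun q => #|[set i : 'I_M | q \in Qs i]| * mono_deg W q)); last first.
      by move=> q _; rewrite -sum_nat_const; apply: eq_bigl => j; rewrite inE.
    apply: leq_sum => q _; rewrite -[leqRHS]mul1n leq_mul2r; apply/orP; right.
    apply/card_le1_eqP => a b; rewrite !inE => qa qb; apply/val_inj.
    by case: (ltngtP a b) => // ab; [have := Qd _ _ ab (ltn_ord b) | have := Qd _ _ ab (ltn_ord a)];
       move=> /disjointFr d; have := d q; rewrite ?qa ?qb => /(_ isT).
  have s2 : M * k.+1 <= 100 * \sum_(i < M) \sum_(q in Qs i) mono_deg W q.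
    rewrite big_distrr /= -[X in X * _]card_ord -sum_nat_const; apply: leq_sum => j _.
    by rewrite ltnNge; exact: h.
  by have := leq_mul (leqnn 100) s1; rewrite mulnS in s2; lia.
exists (decode (Qs i :&: W)).
  apply/bigcupP; exists i => //; apply: imset_f; rewrite inE; exact: subsetIl.
apply: (@decode_ok _ W Out _ ih).
  move=> x xO; apply: Qc => // j jM; apply: contra xO => xj.
  by apply/bigcupP; exists (Ordinal jM).
apply: (leq_trans _ small); rewrite leq_mul2l /= leq_add2l.
apply: (@leq_trans (\sum_(i < M) (#|Qs i| * k))); last first.
  by rewrite -[X in X * _]card_ord -sum_nat_const; apply: leq_sum.
rewrite -big_distrl /= leq_mul2r; apply/orP; right.
exact: card_bigcup_le.
Qed.

Lemma mono_deg_flip (W F : {set T}) v : v \notin F ->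
  mono_deg (flip W F) v <= mono_deg W v + #|nb v :&: F|.
Proof.
move=> vF; apply: leq_cardU; apply/subsetP => w; rewrite !inE (negbTE vF) addbF.
by move=> /andP[-> /=]; case: (w \in F) => /=; rewrite ?orbT // addbF orbF.
Qed.

(** Flipping [v] exchanges its monochromatic and bichromatic edges, except towards other flipped
    vertices. *)
Lemma mono_deg_flip_ge (W F : {set T}) v : v \in F ->
  k <= mono_deg (flip W F) v + mono_deg W v + #|F|.
Proof.
move=> vF; rewrite -(card_nb v) -addnA; apply: (leq_trans _ (leq_add (leqnn _) (leq_cardU (subxx _)))).
apply: leq_cardU; apply/subsetP => w; rewrite !inE vF => -> /=.
by case: (w \in F); case: (w \in W); case: (v \in W).
Qed.

Lemma mono_deg_flip_le (W F : {set T}) v : v \in F ->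
  mono_deg (flip W F) v + mono_deg W v <= k + #|F|.
Proof.
move=> vF; rewrite -(card_nb v) /mono_deg -cardsUI; apply: leq_add; apply: subset_leq_card.
  by apply/subsetP => w; rewrite !inE => /orP[]/andP[].
apply/subsetP => w; rewrite !inE vF.
by case: (w \in F); case: (w \in W); case: (v \in W); rewrite /= ?andbF.
Qed.

Lemma mono_deg_le W v : mono_deg W v <= k.
Proof.
by rewrite -(card_nb v); apply: subset_leq_card; apply/subsetP => w; rewrite inE => /andP[].
Qed.

Lemma sum_card_nbI (F : {set T}) : \sum_v #|nb v :&: F| = k * #|F|.
Proof.
transitivity (\sum_v \sum_(w in F) (e v w : nat)).
  apply: eq_bigr => v _; rewrite -sum1_card big_mkcond [RHS]big_mkcond /=.
  by apply: eq_bigr => w _; rewrite !inE andbC; case: (w \in F); case: (e v w).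
rewrite exchange_big /= mulnC -sum_nat_const; apply: eq_bigr => w _.
rewrite -(card_nb w) -sum1_card big_mkcond [RHS]big_mkcond /=.
by apply: eq_bigr => v _; rewrite inE e_sym; case: (e w v).
Qed.

Lemma mono_flip (W F : {set T}) : mono (flip W F) <= mono W + 2 * k * #|F|.
Proof.
have -> : mono W + 2 * k * #|F| = \sum_v (mono_deg W v + #|nb v :&: F| + (v \in F) * k).
  rewrite !big_split /= sum_card_nbI -/(mono W) -big_distrl /= -addnA -mulnA mul2n -addnn.
  by congr (_ + (_ + _)); rewrite mulnC; congr (_ * _); rewrite -sum1_card big_mkcond.
apply: leq_sum => v _; case: (boolP (v \in F)) => vF; last by rewrite addn0 mono_deg_flip.
by rewrite mul1n; apply: (leq_trans (mono_deg_le _ _)); rewrite leq_addl.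
Qed.

Definition tame E (W : {set T}) := [forall v, 2 * E * mono_deg W v <= (2 * E - 1) * k].

(** Decode [W] to [B] using [200 * j] samples. Every vertex of the difference [F] has many
    monochromatic edges in [W], but by tameness also at least [k / (2 * E)] bichromatic ones, which
    become monochromatic in [B] up to an error [#|F|]. So [F] lies in [Amb B], a set of size
    [O(E * j)] that depends on [B] alone. *)
Lemma card_tame E j : 0 < E -> 0 < j ->
  100 * (10 * j * k + 400 * j * #|T|) <= k * k -> 20 * E * j <= k ->
  #|[set W | tame E W && (mono W <= 2 * j * k)]| <= 200 * j * 2 ^ sample_size * 2 ^ (41 * E * j).
Proof.
move=> E0 j0 small1 small2.
have [fam [cfam famP]] := base_family (200 * j).
pose Amb (B : {set T}) := [set v | k <= 4 * E * mono_deg B v].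
pose fam' := [set B in fam | #|Amb B| <= 41 * E * j].
have sub : [set W | tame E W && (mono W <= 2 * j * k)]
   \subset \bigcup_(B in fam') [set flip B F | F in powerset (Amb B)].
  apply/subsetP => W; rewrite inE => /andP[/forallP tW mW].
  have [||| B Bfam BW] := famP W; [lia | lia | nia |].
  pose F := flip B W.
  have FW v : v \in F -> 49 * k <= 100 * mono_deg W v.
    by rewrite inE leqNgt => h; apply/negP => /BW h'; move: h; rewrite h' addbb.
  have cF : 49 * #|F| <= 200 * j.
    have : #|F| * (49 * k) <= 100 * mono W.
      apply: leq_trans (card_mono_deg_ge W 49 100); rewrite leq_mul2r; apply/orP; right.
      by apply: subset_leq_card; apply/subsetP => v /FW; rewrite inE.
    move=> h; rewrite -(leq_pmul2r k_gt0).
    by apply: (@leq_trans (100 * mono W)); [move: h; lia | move: mW; lia].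
  have BE : B = flip W F by apply/setP => v; rewrite !inE; case: (v \in B); case: (v \in W).
  have FAmb : F \subset Amb B.
    apply/subsetP => v vF; rewrite inE; have := mono_deg_flip_ge W vF; rewrite -BE.
    have := tW v; set a := mono_deg W v; set b := mono_deg B v => h1 h2.
    have h3 : 4 * E * #|F| <= k by nia.
    have h4 : 4 * E * k <= 4 * E * (b + a + #|F|) by rewrite leq_mul2l h2 orbT.
    have h5 : (2 * E - 1) * k = 2 * E * k - k by rewrite mulnBl mul1n.
    have h6 : k <= 2 * E * k by rewrite leq_pmull // muln_gt0.
    move: h4; rewrite !mulnDr; lia.
  (* [49 * #|F| <= 200 * j] keeps [4 * E * (2 * j + 2 * #|F|)] below [41 * E * j]. *)
  have cAmb : #|Amb B| <= 41 * E * j.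
    have s1 := card_mono_deg_ge B 1 (4 * E); rewrite mul1n in s1.
    have s2 : mono B <= mono W + 2 * k * #|F| by rewrite BE mono_flip.
    rewrite -(leq_pmul2r k_gt0); apply: (leq_trans s1).
    apply: (@leq_trans (4 * E * (2 * j * k + 2 * k * #|F|))).
      by rewrite leq_mul2l (leq_trans s2) ?orbT // leq_add2r.
    have : 40 * (E * k) * (49 * #|F|) <= 40 * (E * k) * (200 * j) by rewrite leq_mul2l cF orbT.
    nia.
  apply/bigcupP; exists B; first by rewrite inE Bfam.
  apply/imsetP; exists F; first by rewrite inE.
  by apply/setP => v; rewrite !inE; case: (v \in B); case: (v \in W).
apply: (leq_trans (subset_leq_card sub)).
apply: (@leq_trans (\sum_(B in fam') 2 ^ (41 * E * j))).
  apply: (@leq_trans (\sum_(B in fam') #|[set flip B F | F in powerset (Amb B)]|)).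
    exact: card_bigcup_le.
  apply: leq_sum => B; rewrite inE => /andP[_ cB].
  apply: (leq_trans (leq_imset_card _ _)); by rewrite card_powerset leq_pexp2l.
rewrite sum_nat_const leq_mul2r; apply/orP; right.
apply: leq_trans cfam; apply: subset_leq_card.
by apply/subsetP => B; rewrite inE => /andP[].
Qed.
End Cuts.

(** * Hitting times *)

Lemma hitting_time_le (T : finType) (P : seq {set T} -> bool) s t :
  P (take t s) -> t <= size s -> hitting_time P s <= t.
Proof.
move=> Pt ts; rewrite leqNgt; apply/negP => lt.
have := before_find 0 lt; rewrite nth_iota ?add0n ?Pt //.
Qed.

Lemma hitting_time_sat (T : finType) (P : seq {set T} -> bool) s :
  hitting_time P s <= size s -> P (take (hitting_time P s) s).
Proof.
move=> le; have h : has (fun t => P (take t s)) (iota 0 (size s).+1).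
  by rewrite has_find size_iota.
by have := nth_find 0 h; rewrite nth_iota // add0n.
Qed.

Lemma hitting_time_before (T : finType) (P : seq {set T} -> bool) s t :
  t < hitting_time P s -> t <= size s -> ~~ P (take t s).
Proof. by move=> lt ts; apply/negP => /hitting_time_le/(_ ts); rewrite leqNgt lt. Qed.

Lemma sorted_take_drop (X : eqType) (chi : X -> nat) s t x y :
  sorted leq [seq chi z | z <- s] -> x \in take t s -> y \in drop t s -> chi x <= chi y.
Proof.
rewrite sorted_pairwise; last exact: leq_trans.
rewrite -{1}(cat_take_drop t s) map_cat pairwise_cat => /and3P[/allrelP h _ _] xt yd.
by apply: h; apply: map_f.
Qed.

Import Order.TTheory GRing.Theory Num.Theory.
Local Open Scope ring_scope.

(** * Random colourings and random orderings *)

Lemma expR_natM (R : realType) (x : R) n : expR (n%:R * x) = expR x ^+ n.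
Proof.
elim: n => [|n IH]; first by rewrite mul0r expR0 expr0.
by rewrite -natr1 mulrDl mul1r expRD IH exprSr.
Qed.

Section ProductMeasure.
Variables (R : realType) (X : finType) (p0 p1 : R).
Hypotheses (p0_ge0 : 0 <= p0) (p01 : p0 <= p1) (p1_le1 : p1 <= 1).

Definition colour_weight (i : 'I_3) : R :=
  if nat_of_ord i == 0%N then p0 else if nat_of_ord i == 1%N then p1 - p0 else 1 - p1.

Definition weight (chi : {ffun X -> 'I_3}) : R := \prod_x colour_weight (chi x).

Definition prob (B : pred {ffun X -> 'I_3}) : R := \sum_(chi | B chi) weight chi.

Lemma colour_weight_ge0 i : 0 <= colour_weight i.
Proof. by rewrite /colour_weight; case: ifP => // _; case: ifP => _; rewrite subr_ge0. Qed.

Lemma weight_ge0 chi : 0 <= weight chi.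
Proof. by apply: prodr_ge0 => x _; exact: colour_weight_ge0. Qed.

Lemma expect_prod (g : X -> 'I_3 -> R) :
  \sum_chi weight chi * \prod_x g x (chi x)
  = \prod_x \sum_i colour_weight i * g x i.
Proof.
rewrite (bigA_distr_bigA (fun x i => colour_weight i * g x i)) /=.
by apply: eq_bigr => chi _; rewrite -big_split.
Qed.

Lemma expect_colour (g : 'I_3 -> R) :
  \sum_i colour_weight i * g i
  = p0 * g (inord 0) + (p1 - p0) * g (inord 1) + (1 - p1) * g (inord 2).
Proof.
rewrite 3!big_ord_recl big_ord0 addr0 addrA /colour_weight /=.
by congr (_ * g _ + _ * g _ + _ * g _); apply: ord_inj; rewrite inordK.
Qed.

Lemma Pr_le (B B' : pred {ffun X -> 'I_3}) :
  (forall chi, B chi -> B' chi) -> prob B <= prob B'.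
Proof.
move=> BB'; rewrite /prob big_mkcond [leRHS]big_mkcond; apply: ler_sum => chi _.
by case: ifP => [/BB' ->//|_]; case: ifP => // _; exact: weight_ge0.
Qed.

Lemma Pr_union (I : finType) (P : pred I) (B : pred {ffun X -> 'I_3})
    (C : I -> pred {ffun X -> 'I_3}) :
  (forall chi, B chi -> exists2 i, P i & C i chi) ->
  prob B <= \sum_(i | P i) prob (C i).
Proof.
move=> BC; rewrite /prob.
under [leRHS]eq_bigr do rewrite big_mkcond.
rewrite exchange_big /= big_mkcond; apply: ler_sum => chi _.
have pos i : 0 <= (if C i chi then weight chi else 0).
  by case: ifP => // _; exact: weight_ge0.
case: ifP => [/BC[i Pi Ci]|_]; last exact: sumr_ge0.
by rewrite (bigD1 i) //= Ci lerDl sumr_ge0.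
Qed.

Lemma Pr_predU (B B' : pred {ffun X -> 'I_3}) :
  prob (fun chi => B chi || B' chi) <= prob B + prob B'.
Proof.
have := @Pr_union bool xpredT (fun chi => B chi || B' chi) (fun b => if b then B else B').
rewrite big_bool; apply => chi /orP[h|h]; by [exists true | exists false].
Qed.

Lemma Pr_markov (B : pred {ffun X -> 'I_3}) (f : {ffun X -> 'I_3} -> R) :
  (forall chi, 0 <= f chi) -> (forall chi, B chi -> 1 <= f chi) ->
  prob B <= \sum_chi weight chi * f chi.
Proof.
move=> f_ge0 f_ge1; rewrite /prob big_mkcond; apply: ler_sum => chi _.
case: ifP => [/f_ge1 h|_]; first by rewrite ler_peMr ?weight_ge0.
by rewrite mulr_ge0 ?weight_ge0.
Qed.

Lemma Pr_forall (Y : {set X}) (P : pred 'I_3) :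
  prob (fun chi => [forall x in Y, P (chi x)])
  = (\sum_(i | P i) colour_weight i) ^+ #|Y|.
Proof.
rewrite /prob big_mkcond /=.
pose g x (i : 'I_3) : R := if (x \in Y) && ~~ P i then 0 else 1.
transitivity (\sum_chi weight chi * \prod_x g x (chi x)).
  apply: eq_bigr => chi _; case: ifP => [/forall_inP h|/negbT].
    rewrite big1 ?mulr1 // => x _; rewrite /g.
    by case: ifP => // /andP[xY /negP[]]; exact: h.
  rewrite negb_forall_in => /exists_inP[x xY h0].
  by rewrite (bigD1 x) //= /g xY h0 mul0r mulr0.
rewrite expect_prod -[RHS]prodr_const [RHS]big_mkcond /=; apply: eq_bigr => x _.
case: ifP => xY; last first.
  by under eq_bigr do rewrite /g xY /=; rewrite expect_colour; ring.
rewrite [RHS]big_mkcond; apply: eq_bigr => i _.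
by rewrite /g xY /=; case: (P i); rewrite /= ?mulr1 ?mulr0.
Qed.

Lemma Pr_avoid (Y : {set X}) :
  prob (fun chi => [forall x in Y, nat_of_ord (chi x) != 0%N]) = (1 - p0) ^+ #|Y|.
Proof.
rewrite (Pr_forall Y (fun i => nat_of_ord i != 0%N)); congr (_ ^+ _).
by rewrite big_mkcond 3!big_ord_recl big_ord0 /colour_weight /=; ring.
Qed.

Lemma Pr_avoid1 (Y : {set X}) :
  prob (fun chi => [forall x in Y, (1 < nat_of_ord (chi x))%N]) = (1 - p1) ^+ #|Y|.
Proof.
rewrite (Pr_forall Y (fun i => (1 < nat_of_ord i)%N)); congr (_ ^+ _).
by rewrite big_mkcond 3!big_ord_recl big_ord0 /colour_weight /=; ring.
Qed.

(* Markov's inequality for the product of independent factors [expR (sigma 1_{chi x = 0})];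
   [sigma < 0] gives the lower tail and [sigma > 0] the upper one. *)
Lemma Pr_chernoff (Z Y : {set X}) (sigma z : R) : [disjoint Z & Y] ->
  prob (fun chi => [forall x in Z, (nat_of_ord (chi x) <= 1)%N] &&
     (sigma * z <= sigma * #|[set x in Y | nat_of_ord (chi x) == 0%N]|%:R))
  <= p1 ^+ #|Z| * expR ((expR sigma - 1) * p0 * #|Y|%:R - sigma * z).
Proof.
move=> dZY.
pose g x (i : 'I_3) : R :=
  if x \in Z then (if (nat_of_ord i <= 1)%N then 1 else 0)
  else if (x \in Y) && (nat_of_ord i == 0%N) then expR sigma else 1.
have g_ge0 x i : 0 <= g x i by rewrite /g; do 3?case: ifP => // _; exact: expR_ge0.
apply: (le_trans (Pr_markov (f := fun chi => expR (- (sigma * z)) * \prod_x g x (chi x)) _ _)).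
- by move=> chi; rewrite mulr_ge0 ?expR_ge0 ?prodr_ge0.
- move=> chi /andP[/forall_inP hZ hY].
  rewrite (bigID (mem Y)) /= [X in _ * (_ * X)]big1 ?mulr1; last first.
    by move=> x xY; rewrite /g (negbTE xY) /=; case: ifP => // /hZ ->.
  have -> : \prod_(x in Y) g x (chi x)
          = expR (sigma * #|[set x in Y | nat_of_ord (chi x) == 0%N]|%:R).
    rewrite mulrC expR_natM -prodr_const big_mkcond [RHS]big_mkcond /=.
    apply: eq_bigr => x _; rewrite inE /g; case: ifP => // xY.
    by rewrite (disjointFl dZY xY) xY.
  by rewrite -expRD -[leLHS]expR0 ler_expR; lra.
under eq_bigr do rewrite mulrCA.
rewrite -mulr_sumr expect_prod.
have gE x : \sum_i colour_weight i * g x i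
    = (if x \in Z then p1 else 1) * (if x \in Y then 1 + (expR sigma - 1) * p0 else 1).
  rewrite expect_colour /g !inordK //=; case: ifPn => xZ.
    by rewrite (disjointFr dZY xZ); ring.
  by rewrite andbT !andbF; case: (x \in Y) => /=; ring.
rewrite (eq_bigr _ (fun x _ => gE x)) big_split /= -!big_mkcond /= !prodr_const.
rewrite mulrC -[leLHS]mulrA ler_wpM2l ?exprn_ge0 //; first by move: p0_ge0 p01; lra.
rewrite expRD ler_wpM2r ?expR_ge0 // [_ * #|Y|%:R]mulrC expR_natM lerXn2r //.
- by rewrite nnegrE; move: (expR_ge0 sigma) p0_ge0 p01 p1_le1; nra.
- by rewrite nnegrE expR_ge0.
- exact: expR_ge1Dx.
Qed.

End ProductMeasure.

Section Transfer.
Variables (R : realType) (X : finType) (A : {set X}) (p0 p1 : R).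
Hypotheses (p0_ge0 : 0 <= p0) (p01 : p0 <= p1) (p1_le1 : p1 <= 1).

Lemma Pr_perm (pi : {perm X}) (B : pred {ffun X -> 'I_3}) :
  prob p0 p1 (fun chi => B [ffun x => chi (pi x)]) = prob p0 p1 B.
Proof.
pose act (s : {perm X}) (chi : {ffun X -> 'I_3}) := [ffun x => chi (s x)].
have actK s : cancel (act s) (act (s^-1)%g).
  by move=> chi; apply/ffunP => x; rewrite !ffunE permKV.
have actKV s : cancel (act (s^-1)%g) (act s).
  by move=> chi; apply/ffunP => x; rewrite !ffunE permK.
rewrite /prob [RHS](reindex (act pi)) /=; last first.
  by exists (act (pi^-1)%g) => chi _; [exact: actK | exact: actKV].
apply: eq_bigr => chi _; rewrite /weight (reindex_inj (@perm_inj _ pi)) /=.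
by apply: eq_bigr => x _; rewrite ffunE.
Qed.

Lemma Pr_true : prob p0 p1 (fun _ : {ffun X -> 'I_3} => true) = 1.
Proof.
transitivity ((1 - p0) ^+ #|(set0 : {set X})|); last by rewrite cards0.
rewrite -(Pr_avoid p0 p1) /prob; apply: eq_bigl => chi.
by symmetry; apply/forall_inP => x; rewrite inE.
Qed.

(** The permutations supported on [A] act simply transitively on the orderings of [A]. Only
    injectivity is checked directly; both sides having [#|A|] factorial elements gives the rest. *)
Lemma count_orderings (fail : pred (seq X)) (s0 : seq X) : perm_eq s0 (enum A) ->
  count fail (permutations (enum A))
  = #|[set pi : {perm X} | perm_on A pi && fail (map pi s0)]|.
Proof.
move=> s0A.
have memA x : (x \in s0) = (x \in A) by rewrite (perm_mem s0A) mem_enum.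
have us0 : uniq s0 by rewrite (perm_uniq s0A) enum_uniq.
pose L := [seq map (pi : {perm X}) s0 | pi <- enum [set pi : {perm X} | perm_on A pi]].
have uL : uniq L.
  rewrite map_inj_in_uniq ?enum_uniq // => p p'; rewrite !mem_enum !inE => pA p'A.
  move=> /eq_in_map epp; apply/permP => x; case: (boolP (x \in A)) => xA.
    by apply: epp; rewrite memA.
  by rewrite (out_perm pA xA) (out_perm p'A xA).
have sL : {subset L <= permutations (enum A)}.
  move=> s /mapP[p]; rewrite mem_enum inE => pA ->; rewrite mem_permutations.
  apply: uniq_perm; rewrite ?enum_uniq ?(map_inj_uniq perm_inj) // => x.
  rewrite mem_enum; apply/mapP/idP => [[y ys ->]|xA].
    by rewrite (perm_closed _ pA) -memA.
  by exists ((p^-1)%g x); rewrite ?permKV // memA (perm_closed _ (perm_onV pA)).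
have szL : size L = #|A|`!.
  by rewrite size_map -cardE -(card_perm A); apply: eq_card => p; rewrite inE.
have [] := uniq_min_size uL sL; first by rewrite size_permutations ?enum_uniq // -cardE szL.
move=> _ eqL.
have /seq.permP -> : perm_eq (permutations (enum A)) L.
  by apply: uniq_perm => //; first exact: permutations_uniq.
rewrite /L count_map cardE -size_filter /=.
rewrite (eq_filter (a2 := mem [set pi : {perm X} | fail (map pi s0)])); last first.
  by move=> p; rewrite /= !inE.
by rewrite -filter_predI; congr (size _); apply: eq_filter => p; rewrite /= !inE andbC.
Qed.

(* A product measure is invariant under permutations of the ground set, so a colouring drawn
   from it can be composed with a random permutation; for a fixed colouring, permuting one
   ordering sorted by colour then gives a uniformly random ordering sorted by the new colours. *)
Lemma count_le_Pr (fail : pred (seq X)) (bad : pred {ffun X -> 'I_3}) :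
  (forall s (chi : {ffun X -> 'I_3}), perm_eq s (enum A) ->
     sorted leq [seq nat_of_ord (chi x) | x <- s] -> fail s -> bad chi) ->
  (count fail (permutations (enum A)))%:R <= prob p0 p1 bad * (#|A|`!)%:R.
Proof.
move=> failbad.
have -> : prob p0 p1 bad * (#|A|`!)%:R
  = \sum_(pi : {perm X} | perm_on A pi)
      prob p0 p1 (fun chi => bad [ffun x => chi ((pi^-1)%g x)]).
  rewrite (eq_bigr (fun=> prob p0 p1 bad)); last by move=> pi _; exact: Pr_perm.
  rewrite sumr_const mulr_natr; congr (_ *+ _).
  by rewrite -(card_perm A); apply: eq_card => p; rewrite ?inE.
rewrite /prob; under eq_bigr do rewrite big_mkcond.
rewrite exchange_big /= -[leLHS]mul1r -{1}Pr_true mulr_suml; apply: ler_sum => chi _.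
pose s0 := sort (relpre (fun x => nat_of_ord (chi x)) leq) (enum A).
have s0A : perm_eq s0 (enum A) by rewrite perm_sort.
rewrite (count_orderings _ s0A). rewrite -sum1_card natr_sum mulr_sumr mulr1.
rewrite (eq_bigl (fun pi : {perm X} => perm_on A pi && fail (map pi s0))); last first.
  by move=> p; rewrite inE.
rewrite big_mkcondr; apply: ler_sum => pi piA.
case: ifP => [fs|_]; last by case: ifP => // _; exact: weight_ge0.
rewrite (failbad _ _ _ _ fs) //.
- apply: uniq_perm; rewrite ?(map_inj_uniq perm_inj) ?(perm_uniq s0A) ?enum_uniq //.
  move=> x; rewrite mem_enum.
  apply/mapP/idP => [[y]|xA]; first by rewrite (perm_mem s0A) mem_enum => yA ->; rewrite (perm_closed _ piA).
  by exists ((pi^-1)%g x); rewrite ?permKV // (perm_mem s0A) mem_enum (perm_closed _ (perm_onV piA)).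
- rewrite -map_comp (eq_map (g := fun x => nat_of_ord (chi x))); last first.
    by move=> x; rewrite /= ffunE permK.
  by rewrite sorted_map sort_sorted // => x y; exact: leq_total.
Qed.
End Transfer.

(** * Independent sets in the intermediate graph *)

Lemma low_arith (R : realFieldType) (L d d' : R) : L <= 50 * d -> d <= d' + 2 -> L - 100 <= 50 * d'.
Proof. by move=> *; lra. Qed.

(** The final count, with [a], [b], [g] the numbers of relevant vertices flipped out, flipped in and
    bad, [J] the level, [x] and [M] the monochromatic degree sums inside the cut and in total. [A1]
    bounds [a] by [b / 2 + J / 100], so [s1] forces [x] above [k * (1 + b / 2 + 0.98 * J)], whereas
    [B1] keeps it below [k * (0.04 * b + 0.08 * g + 0.0008 * J)]. *)
Lemma core_arith (R : realFieldType) (L k N x M w J a b g t t' i0 c fe : R) : 400 <= L -> 0 < k ->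
  0 <= a -> 0 <= b -> J * (2 * k) <= M -> c <= t -> i0 <= t' -> fe <= b + 2 * g ->
  N + 1 + b <= w + a + g -> x + x + k * (2 * N) = M + 2 * k * w -> x <= M ->
  a * (L - 100) <= 50 * c -> t * 10000 <= 50 * (a + b) * L + J * L ->
  t' * 10000 <= 50 * fe * L + J * L -> g * 10000 <= J ->
  (k <= x -> M <= 3 * x -> x * L <= 8 * k * i0) -> False.
Proof.
move=> L_ge kp a_ge0 b_ge0 lev c1 i1 i2 s0' s1 xM c2 t1 t2 t3 many.
have Lp : 0 < L by apply: lt_le_trans L_ge; rewrite ltr0n.
have A1 : 100 * a <= 50 * b + J.
  have aL : a * 400 <= a * L by rewrite ler_wpM2l.
  by rewrite -(ler_pM2r Lp); move: aL c2 c1 t1; clear; lra.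
have s0K : (N + 1 + b) * k <= (w + a + g) * k by rewrite ler_pM2r.
have A1K : 100 * a * k <= (50 * b + J) * k by rewrite ler_pM2r.
have t3K : g * 10000 * k <= J * k by rewrite ler_pM2r.
have bK : 0 <= b * k by rewrite mulr_ge0 // ltW.
have xK : k <= x by move: s0K A1K t3K lev s1 kp bK xM; clear; lra.
have Mx : M <= 3 * x by move: s0K A1K t3K lev s1 kp bK xM; clear; lra.
have {}many := many xK Mx.
have i0L : i0 * 10000 <= (50 * (b + 2 * g) + J) * L.
  by have := ler_wpM2r (ltW Lp) i2; move: i1 t2; clear; lra.
have B1 : x * 10000 <= 8 * k * (50 * (b + 2 * g) + J).
  rewrite -(ler_pM2r Lp); have := ler_wpM2l (ltW kp) i0L; move: many; clear; lra.
by move: B1 s0K A1K t3K lev s1 kp bK xM Mx xK; clear; lra.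
Qed.

Section Core.
(* [L] stands for [log n]; [E] is the inverse of a small absolute constant. *)
Variables (R : realType) (T : finType) (e : rel T) (k n E : nat) (L : R).
Hypotheses (k_gt0 : (0 < k)%N) (e_sym : symmetric e).
Hypothesis e_reg : forall x, #|[set y | e x y]| = k.
Hypothesis cardT : #|T| = (2 * n)%N.

Local Notation nb := (nb e).
Local Notation mono_deg := (mono_deg e).
Local Notation mono := (mono e).

Definition mono_in (W : {set T}) : nat := \sum_(v in W) mono_deg W v.
(* [mono W] counts every edge twice, so the level is the number of monochromatic edges
   in units of [k]. *)
Definition level (W : {set T}) : nat := mono W %/ (2 * k).
Definition inner (W : {set T}) : {set {set T}} :=
  [set [set v; w] | v in W, w in nb v :&: W].
(** The edges at [Fa] whose number is bounded through [#|Fa|] alone: those monochromatic for a cut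
    that has few of them at each vertex of [Fa], and those to a small set [Fb]. *)
Definition touch (W Fa Fb : {set T}) : {set {set T}} :=
  [set [set v; w] | v in Fa, w in [set w in nb v | ((w \in W) == (v \in W)) || (w \in Fb)]].

(** Double counting of the edges between [W] and its complement. A set with more than [n] vertices
    thus spans more edges than its complement does. *)
Lemma mono_in_out (W : {set T}) :
  (mono_in W + mono_in W + k * (2 * n) = mono W + 2 * k * #|W|)%N.
Proof.
have dec v : (k = mono_deg W v + #|[set w in nb v | (w \in W) != (v \in W)]|)%N.
  rewrite -(card_nb e_reg v) -[LHS](cardsID [set w | (w \in W) == (v \in W)]).
  by congr (_ + _)%N; apply: eq_card => w; rewrite !inE // andbC.
have crossE : (\sum_(v in W) #|[set w in nb v | (w \in W) != (v \in W)]|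
   = \sum_(v in ~: W) #|[set w in nb v | (w \in W) != (v \in W)]|)%N.
  transitivity (\sum_(v in W) \sum_(w in ~: W) (e v w : nat))%N.
    apply: eq_bigr => v vW; rewrite -sum1_card big_mkcond [RHS]big_mkcond /=.
    apply: eq_bigr => w _; rewrite !inE vW; case: (w \in W); case: (e v w) => //.
  rewrite exchange_big /=; apply: eq_bigr => v; rewrite inE => vW.
  rewrite -sum1_card big_mkcond [RHS]big_mkcond /=.
  apply: eq_bigr => w _; rewrite !inE (negbTE vW) e_sym; case: (w \in W); case: (e v w) => //.
have h1 : (k * #|W| = mono_in W + \sum_(v in W) #|[set w in nb v | (w \in W) != (v \in W)]|)%N.
  by rewrite /mono_in -big_split /= mulnC -sum_nat_const; apply: eq_bigr.
have h2 : (k * #|~: W| = \sum_(v in ~: W) mono_deg W v + \sum_(v in ~: W) #|[set w in nb v | (w \in W) != (v \in W)]|)%N.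
  by rewrite -big_split /= mulnC -sum_nat_const; apply: eq_bigr.
have h3 : (mono W = mono_in W + \sum_(v in ~: W) mono_deg W v)%N.
  by rewrite /mono (bigID (mem W)) /=; congr addn; apply: eq_bigl => v; rewrite inE.
have h4 : (#|W| + #|~: W| = 2 * n)%N by rewrite cardsC.
have : (k * (#|W| + #|~: W|) = k * (2 * n))%N by rewrite h4.
rewrite mulnDr; lia.
Qed.

Lemma card_flip (W F : {set T}) : (#|flip W F| + #|F :&: W| = #|W| + #|F :\: W|)%N.
Proof.
have -> : flip W F = (W :\: F) :|: (F :\: W).
  by apply/setP => v; rewrite !inE; case: (v \in W); case: (v \in F).
rewrite cardsU (_ : _ :&: _ = set0) ?cards0 ?subn0; last first.
  by apply/setP => v; rewrite !inE; case: (v \in W); case: (v \in F).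
by have := cardsID F W; rewrite setIC; lia.
Qed.

Variables (H0 H1 : {set {set T}}).
Hypothesis H01 : H0 \subset H1.

Definition joined (H : {set {set T}}) : rel T := fun v w => e v w && ([set v; w] \in H).
Definition low_degree v : bool := 50 * #|[set w in nb v | [set v; w] \in H0]|%:R < L.
(** [H1] stands in for the graph at time [tau_I], which is only known to be contained in it. *)
Definition bad (W : {set T}) v : bool := low_degree v &&
  [exists w, exists w', [&& joined H1 v w, joined H1 w w' & (w \in W) == (w' \in W)]].

Definition spread_low := forall v p, path (joined H1) v p -> uniq (v :: p) ->
  (0 < size p <= 4)%N -> low_degree v -> low_degree (last v p) -> False.
Definition empty_inner_small := forall W : {set T}, inner W :&: H0 = set0 ->
  (mono_in W)%:R * L <= 8 * (n * k)%:R.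
Definition light (W : {set T}) := tame e k E W && ((mono W)%:R * L <= 64 * (n * k)%:R).
Definition sparse_touch := forall W Fa Fb : {set T}, light W ->
  (forall v, v \in Fa -> E * mono_deg W v <= 2 * k)%N -> (E * #|Fb| <= k)%N ->
  #|touch W Fa Fb :&: H0|%:R * 10000 <= 50 * (#|Fa| + #|Fb|)%:R * L + (level W)%:R * L.
Definition many_inner := forall W : {set T}, light W -> (k <= mono_in W)%N ->
  (mono W <= 3 * mono_in W)%N -> (mono_in W)%:R * L <= 8 * k%:R * #|inner W :&: H0|%:R.
Definition few_bad := forall W : {set T}, light W ->
  #|[set v | bad W v]|%:R * 10000 <= (level W)%:R :> R.

Lemma joined_sym H : symmetric (joined H).
Proof. by move=> v w; rewrite /joined e_sym setUC. Qed.

Lemma low_walk v p : spread_low -> path (joined H1) v p -> (size p <= 4)%N ->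
  low_degree v -> low_degree (last v p) -> last v p = v.
Proof.
move=> sl /shortenP[p' pp' up' sub] szp lv lp.
have szp' : (size p' <= 4)%N by apply: leq_trans szp; exact: (uniq_leq_size (proj2 (andP up')) sub).
case: p' pp' up' szp' lp {sub} => // w p' pp' up' szp' lp.
by case: (sl v (w :: p') pp' up' _ lv lp).
Qed.

Hypotheses (E_ge3 : (3 <= E)%N) (L_ge : 400 <= L) (L_big : 240 * (E * n)%:R <= k%:R * L).
Hypotheses (Hspread : spread_low) (Hdense : empty_inner_small) (Hsparse : sparse_touch).
Hypotheses (Hmany : many_inner) (Hbad : few_bad).

(** * Flipping a large independent set into a tame cut *)

Section Independent.
Variables (f : rel T) (W : {set T}).
Hypotheses (fH1 : forall v w, f v w -> joined H1 v w).
Hypotheses (fH0 : forall v w, joined H0 v w -> f v w) (f_total : forall v, exists w, f v w).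
Hypotheses (Wind : forall v w, v \in W -> w \in W -> ~~ f v w) (Wbig : (n < #|W|)%N).

(** The threshold [1 - 1 / E] serves both sides, given [#|F| <= k / (10 * E)]: a flipped vertex
    keeps at most [2 * k / E] monochromatic edges, and an unflipped one stays below the fraction
    [1 - 1 / (2 * E)] required by [tame]. *)
Let F := [set v | ((E - 1) * k <= E * mono_deg W v)%N].
Let W1 := flip W F.

(** As [W] has more than [n] vertices, at least half of [mono W] is accounted for inside [W], where
    [H0] has no edge at all. *)
Lemma monoW_small : (mono W)%:R * L <= 16 * (n * k)%:R.
Proof.
have W0 : inner W :&: H0 = set0.
  apply/setP => S; rewrite !inE; apply/negP => /andP[/imset2P[v w vW]].
  rewrite !inE => /andP[vw wW] -> H0vw.
  by have /negP := Wind vW wW; apply; apply: fH0; rewrite /joined vw.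
have h := Hdense W0.
have : (mono W <= 2 * mono_in W)%N.
  have := mono_in_out W; have : (2 * k * n <= 2 * k * #|W|)%N by rewrite leq_mul2l (ltnW Wbig) orbT.
  lia.
rewrite -(ler_nat R) natrM => h2.
apply: (@le_trans _ _ (2 * ((mono_in W)%:R * L))); last by lra.
by rewrite mulrA ler_wpM2r //; move: L_ge; lra.
Qed.

Lemma cardF : (E * #|F| * 10 <= k)%N.
Proof.
have h : (#|F| * ((E - 1) * k) <= E * mono W)%N by exact: (card_mono_deg_ge e k W (E - 1) E).
have h1 : (2 * E * k * #|F| <= 3 * E * mono W)%N.
  have h2 : (2 * E * k * #|F| <= 3 * (#|F| * ((E - 1) * k)))%N.
    have -> : (3 * (#|F| * ((E - 1) * k)) = (3 * (E - 1)) * k * #|F|)%N by ring.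
    by rewrite !leq_mul2r; apply/orP; right; apply/orP; right; lia.
  by apply: (leq_trans h2); rewrite -mulnA leq_mul2l /=.
have h3 : (2 * k * #|F| <= 3 * mono W)%N.
  by rewrite -(@leq_pmul2l E) ?(ltn_trans _ E_ge3) //; move: h1; lia.
have := monoW_small; move: h3 L_big; rewrite -!(ler_nat R) !natrM.
have kp : 0 < k%:R :> R by rewrite ltr0n.
have Lp : 0 < L by move: L_ge; lra.
move: kp Lp; set K := k%:R; set f0 := #|F|%:R; set m := (mono W)%:R; set N := n%:R; set EE := E%:R.
move=> kp Lp h3 LB h4.
have s1 : 2 * K * f0 * L <= 48 * (N * K).
  apply: (@le_trans _ _ (3 * m * L)); first by rewrite ler_wpM2r // ltW.
  by rewrite -mulrA; move: h4; lra.
have s2 : f0 * L <= 24 * N by rewrite -(ler_pM2r kp); move: s1; lra.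
have E0 : 0 <= EE by rewrite /EE ler0n.
rewrite -(ler_pM2r Lp); apply: le_trans LB.
by have := ler_wpM2l E0 s2; lra.
Qed.

Lemma deg_flipF v : v \in F -> (E * mono_deg W1 v <= 2 * k)%N.
Proof.
move=> vF; have := mono_deg_flip_le e_reg W vF; have := cardF.
rewrite inE in vF; rewrite -/W1; move: vF; set a := mono_deg W v; set b := mono_deg W1 v.
set c := #|F| => vF cF h.
have : (E * (b + a) <= E * (k + c))%N by rewrite leq_mul2l h orbT.
rewrite !mulnDr; have : (E * k = (E - 1) * k + k)%N by rewrite -mulSnr; congr (_ * _)%N; lia.
lia.
Qed.

Lemma light_W1 : light W1.
Proof.
apply/andP; split.
  apply/forallP => v; have cF := cardF.
  have EE : ((2 * E - 1) * k = 2 * (E - 1) * k + k)%N by rewrite -mulSnr; congr (_ * _)%N; lia.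
  have Ek : (2 * k <= (E - 1) * k)%N by rewrite leq_mul2r; apply/orP; right; lia.
  case: (boolP (v \in F)) => vF; first by have := deg_flipF vF; lia.
  have h := mono_deg_flip e W vF; rewrite -/W1 in h.
  have h' : (#|nb v :&: F| <= #|F|)%N by rewrite subset_leq_card // subsetIr.
  have h2 : (2 * E * mono_deg W1 v <= 2 * E * (mono_deg W v + #|F|))%N.
    by rewrite leq_mul2l; apply/orP; right; apply: (leq_trans h); rewrite leq_add2l.
  move: vF; rewrite inE -ltnNge => vF; move: h2; rewrite mulnDr; lia.
have h := mono_flip e_sym e_reg W F; rewrite -/W1 in h.
have cF : (2 * k * #|F| <= 3 * mono W)%N.
  have h1 : (#|F| * ((E - 1) * k) <= E * mono W)%N by exact: (card_mono_deg_ge e k W (E - 1) E).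
  rewrite -(@leq_pmul2l E) ?(ltn_trans _ E_ge3) //.
  have : (2 * E * k * #|F| <= 3 * (E - 1) * k * #|F|)%N.
    by rewrite !leq_mul2r; apply/orP; right; apply/orP; right; lia.
  move: h1; lia.
have : (mono W1 <= 4 * mono W)%N by lia.
rewrite -(ler_nat R) natrM => h3; have := monoW_small.
have : (mono W1)%:R * L <= 4 * (mono W)%:R * L by rewrite ler_wpM2r //; move: L_ge; lra.
lra.
Qed.


Let m v := xchoose (f_total v).
Let fm v : f v (m v). Proof. exact: xchooseP. Qed.
(** Vertices leaving [W] are split by degree. From those entering, the partners [PL] of low-degree
    leavers and the low-degree vertices are removed, so that [Fb1] is what remains after
    cancellation. *)
Let Fa0 := [set v in F | (v \in W) && ~~ low_degree v].
Let FaL := [set v in F | (v \in W) && low_degree v].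
Let Fb := F :\: W.
Let PL := [set m v | v in [set v in FaL | m v \in Fb]].
Let Fb1 := [set v in Fb | ~~ low_degree v & v \notin PL].
Let Bad := [set v | bad W1 v].

Let near u w := (u == w) || joined H1 u w.

(** Both [u] and [u'] are within distance 2 of [v], so a walk of length at most 4 joins them. *)
Lemma low_near u u' a v b : low_degree u -> low_degree u' -> near u a -> joined H1 a v ->
  joined H1 v b -> near u' b -> u = u'.
Proof.
rewrite /near => lu lu' /orP[/eqP<-|ua] av vb /orP[/eqP eb|ub].
- have := @low_walk u [:: v; b] Hspread; rewrite /= av vb -eb => h.
  by symmetry; apply: h.
- have := @low_walk u [:: v; b; u'] Hspread; rewrite /= av vb (joined_sym H1 b) ub => h.
  by symmetry; apply: h.
- have := @low_walk u [:: a; v; b] Hspread; rewrite /= ua av vb -eb => h.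
  by symmetry; apply: h.
- have := @low_walk u [:: a; v; b; u'] Hspread; rewrite /= ua av vb (joined_sym H1 b) ub => h.
  by symmetry; apply: h.
Qed.

Lemma W1E v : (v \in W1) = (v \in W) (+) (v \in F).
Proof. by rewrite inE. Qed.

(** If the partner stays outside while [v] leaves [W], the edge between them becomes monochromatic
    for [W1]; the walk in [bad] goes to the partner and back. *)
Lemma bad_FaL v : v \in FaL -> m v \notin Fb -> bad W1 v.
Proof.
move=> vFaL mvFb; have /and3P[vF vW lv] : [&& v \in F, v \in W & low_degree v].
  by move: vFaL; rewrite in_set.
have mW : m v \notin W by apply/negP => mW; have := Wind vW mW; rewrite fm.
have mF : m v \notin F by apply: contra mvFb => h; rewrite in_setD h mW.
rewrite /bad lv /=; apply/existsP; exists (m v); apply/existsP; exists v.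
by rewrite (fH1 (fm v)) joined_sym (fH1 (fm v)) !W1E vW vF (negbTE mW) (negbTE mF).
Qed.

(** The flip loses [Fa0] and [FaL] and gains [Fb]. The loss [FaL] is repaid by the partners in [PL],
    which lie in [Fb], except for bad vertices; [Fb1] is a further gain. *)
Lemma sizes : (n < #|W1| + #|Fa0| + #|Bad| - #|Fb1|)%N.
Proof.
have h1 : (#|FaL| <= #|PL| + #|Bad|)%N.
  rewrite card_in_imset; last first.
    move=> v v'; rewrite !inE => /andP[/and3P[_ _ lv] _] /andP[/and3P[_ _ lv'] _] emm.
    have := @low_walk v [:: m v; v'] Hspread; rewrite /= (fH1 (fm v)) emm joined_sym (fH1 (fm v')).
    by move=> h; symmetry; apply: h.
  apply: leq_cardU; apply/subsetP => v vF; rewrite in_setU in_set vF /= [v \in Bad]in_set.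
  by case: (boolP (m v \in Fb)) => //= h; exact: bad_FaL.
have h2 : (#|PL| + #|Fb1| <= #|Fb|)%N.
  rewrite -(cardsID PL Fb) leq_add //; apply: subset_leq_card.
    apply/subsetP => w wPL; rewrite inE wPL andbT.
    by case/imsetP: wPL => v; rewrite inE => /andP[_ h] ->.
  by apply/subsetP => w; rewrite !in_set => /andP[/andP[-> ->]] /andP[_ ->].
have h3 : (#|F :&: W| = #|Fa0| + #|FaL|)%N.
  rewrite -(cardsID [set v | ~~ low_degree v]); congr (_ + _)%N; apply: eq_card => v.
    by rewrite !inE // andbA.
  by rewrite !inE negbK andbC -andbA.
have := card_flip W F; rewrite h3 -/W1 -/Fb; move: Wbig; lia.
Qed.

Let Fe := Fb1 :|: (Bad :&: F) :|: ([set m v | v in Bad] :&: F).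

(** Independence of [W] puts one end [v] of the edge outside [W], so [v] was flipped in. If [v] has
    low degree, the edge makes it bad; if [v] is the partner of a low-degree [u], the walk from [u]
    through [v] along the edge makes [u] bad; otherwise [v] is in [Fb1]. *)
Lemma inner_touch : inner W1 :&: H0 \subset touch W1 Fe set0 :&: H0.
Proof.
have key v w : v \in W1 -> w \in W1 -> e v w -> [set v; w] \in H0 -> v \notin W -> v \in Fe.
  move=> vW1 wW1 vw vwH vW.
  have vwH1 : joined H1 v w by rewrite /joined vw (subsetP H01).
  have vF : v \in F by move: vW1; rewrite W1E (negbTE vW).
  have same : (v \in W1) == (w \in W1) by rewrite vW1 wW1.
  rewrite !in_setU !in_setI vF !andbT.
  case: (boolP (low_degree v)) => lv.
    apply/orP; left; apply/orP; right; rewrite in_set /bad lv /=.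
    by apply/existsP; exists w; apply/existsP; exists v; rewrite vwH1 joined_sym vwH1 eq_sym.
  case: (boolP (v \in PL)) => vP; last first.
    by rewrite [v \in Fb1]in_set lv vP in_setD vF vW.
  case/imsetP: vP => u; rewrite !in_set => /andP[/andP[_ /andP[_ lu]] _] ve.
  apply/orP; right; apply/imsetP; exists u => //; rewrite in_set /bad lu /=.
  by apply/existsP; exists v; apply/existsP; exists w; rewrite vwH1 same ve (fH1 (fm u)).
apply/subsetP => S; rewrite !in_setI => /andP[/imset2P[v w vW1]].
rewrite in_setI in_set => /andP[vw wW1] -> SH; rewrite SH andbT.
have [vW|wW] : v \notin W \/ w \notin W.
  apply/orP; rewrite -negb_and; apply/negP => /andP[vW wW].
  by have := Wind vW wW; rewrite fH0 // /joined vw.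
- apply: imset2_f; first exact: (key v w).
  by rewrite in_set [w \in nb v]in_set vw vW1 wW1.
- rewrite setUC; apply: imset2_f; last by rewrite in_set [v \in nb w]in_set e_sym vw vW1 wW1.
  by apply: (key w v) => //; [rewrite e_sym | rewrite setUC].
Qed.

Lemma card_Fe : (#|Fe| <= #|Fb1| + 2 * #|Bad|)%N.
Proof.
apply: (leq_trans (leq_cardU (subxx _))); rewrite mul2n -addnn addnA leq_add //.
  apply: (leq_trans (leq_cardU (subxx _))); rewrite leq_add2l.
  by rewrite subset_leq_card // subsetIl.
apply: (@leq_trans #|[set m v | v in Bad]|); last exact: leq_imset_card.
by rewrite subset_leq_card // subsetIl.
Qed.

Let D v := [set w in nb v | [set v; w] \in H0].
Let D' v := [set w in D v | ((w \in W1) == (v \in W1)) || (w \in Fb1)].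

(** An [H0]-neighbour of [v] lies outside [W]. If it misses [D' v], it was flipped in and is a
    low-degree vertex [u] or a partner [m u] of one. Such a [u] is within distance 2 of [v], hence
    unique, which leaves only [u] and [m u]. *)
Lemma card_D v : v \in Fa0 -> (#|D v| <= #|D' v| + 2)%N.
Proof.
rewrite inE => /and3P[vF vW lv].
have vW1 : v \notin W1 by rewrite W1E vW vF.
have ex w : w \in D v :\: D' v -> joined H1 v w /\ exists u, [/\ low_degree u, near u w & (w == u) || (w == m u)].
  rewrite in_setD [w \in D' v]in_set => /andP[h wD]; rewrite wD /= (negbTE vW1) negb_or in h.
  move: wD; rewrite !in_set => /andP[vw vwH].
  have vwH1 : joined H1 v w by rewrite /joined vw (subsetP H01).
  split=> //; case/andP: h => wW1 wFb1.
  have wW : w \notin W by apply/negP => wW; have := Wind vW wW; rewrite fH0 // /joined vw.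
  have wF : w \in F by move: wW1; rewrite W1E (negbTE wW) /=; case: (w \in F).
  case: (boolP (low_degree w)) => lw; first by exists w; rewrite /near eqxx.
  move: wFb1; rewrite [w \in Fb1]in_set in_setD wF wW lw /= negbK => /imsetP[u].
  rewrite !in_set => /andP[/andP[_ /andP[_ lu]] _] ->; exists u.
  by rewrite /near (fH1 (fm u)) lu eqxx !orbT.
rewrite -(cardsID (D' v) (D v)) leq_add //; first by rewrite subset_leq_card // subsetIr.
have [->|[w0 w0D]] := set_0Vmem (D v :\: D' v); first by rewrite cards0.
have [vw0 [u0 [lu0 nu0 _]]] := ex w0 w0D.
apply: (@leq_trans #|[set u0; m u0]|); last by rewrite cards2; case: eqP.
apply/subset_leq_card/subsetP => w wD; have [vw [u [lu nu eu]]] := ex w wD.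
have -> : u0 = u by apply: (low_near lu0 lu nu0 _ vw nu); rewrite joined_sym.
by rewrite !inE.
Qed.

Lemma card_touch : (\sum_(v in Fa0) #|D' v| <= #|touch W1 Fa0 Fb1 :&: H0|)%N.
Proof.
rewrite -card_edges => [|v w].
  apply/subset_leq_card/subsetP => S /imset2P[v w vFa]; rewrite [w \in D' v]in_set => /andP[wD h] ->.
  have /andP[vw vwH] : e v w && ([set v; w] \in H0) by move: wD; rewrite !in_set.
  rewrite in_setI vwH andbT.
  by apply: imset2_f => //; rewrite in_set [w \in nb v]in_set vw.
rewrite !in_set => /and3P[_ vW _] /andP[/andP[vw vwH] _]; apply/negP => /and3P[_ wW _].
by have := Wind vW wW; rewrite fH0 // /joined vw.
Qed.

Lemma independent_absurd : False.
Proof.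
have lW1 := light_W1.
have cF := cardF.
have FbF : (E * #|Fb1| <= k)%N.
  apply: leq_trans cF; rewrite -mulnA leq_mul2l; apply/orP; right.
  apply: (@leq_trans #|F|); last by rewrite leq_pmulr.
  by apply/subset_leq_card/subsetP => v; rewrite !in_set => /andP[/andP[_ ->]].
have t1 := @Hsparse W1 Fa0 Fb1 lW1.
have /t1 {}t1 : forall v, v \in Fa0 -> (E * mono_deg W1 v <= 2 * k)%N.
  by move=> v; rewrite in_set => /andP[/deg_flipF].
have {}t1 := t1 FbF.
have t2 := @Hsparse W1 Fe set0 lW1.
have /t2 {}t2 : forall v, v \in Fe -> (E * mono_deg W1 v <= 2 * k)%N.
  move=> v; rewrite !in_setU !in_setI => /orP[/orP[|]|] h; apply: deg_flipF.
  - by move: h; rewrite in_set => /andP[]; rewrite in_setD => /andP[].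
  - by case/andP: h.
  - by case/andP: h.
rewrite cards0 muln0 addn0 in t2; have {}t2 := t2 isT.
have t3 := Hbad lW1.
have i1 := subset_leq_card inner_touch.
have i2 := card_Fe.
have s0 := sizes.
have s1 := mono_in_out W1.
have lev : (level W1 * (2 * k) <= mono W1)%N by exact: leq_trunc_div.
have c1 := card_touch.
have c2 : #|Fa0|%:R * (L - 100) <= 50 * (\sum_(v in Fa0) #|D' v|)%:R.
  rewrite natr_sum mulr_sumr mulrC mulr_natr -sumr_const; apply: ler_sum => v vFa.
  have := card_D vFa; rewrite -(ler_nat R) natrD; apply: low_arith.
  by move: vFa; rewrite in_set -leNgt => /and3P[_ _].
have monoM : (mono_in W1 <= mono W1)%N.
  by rewrite /mono (bigID (mem W1)) leq_addr.
have s0' : (n + 1 + #|Fb1| <= #|W1| + #|Fa0| + #|Bad|)%N.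
  by move: s0; rewrite ltn_subRL addn1 addSn (addnC n).
have := core_arith L_ge (k:=k%:R) (N:=n%:R) (x:=(mono_in W1)%:R) (M:=(mono W1)%:R) (w:=#|W1|%:R)
  (J := (level W1)%:R) (a:=#|Fa0|%:R) (b:=#|Fb1|%:R) (g:=#|Bad|%:R)
  (t:=#|touch W1 Fa0 Fb1 :&: H0|%:R) (t':=#|touch W1 Fe set0 :&: H0|%:R)
  (i0:=#|inner W1 :&: H0|%:R) (c:=(\sum_(v in Fa0) #|D' v|)%:R) (fe:=#|Fe|%:R).
apply; rewrite ?ler0n ?ltr0n //.
- by move: lev; rewrite -(ler_nat R) !natrM.
- by rewrite ler_nat.
- by rewrite ler_nat.
- by move: i2; rewrite -(ler_nat R) natrD natrM.
- by move: s0'; rewrite -(ler_nat R) !natrD.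
- by move: s1 => /(congr1 (fun x => x%:R : R)); rewrite !natrD !natrM.
- by rewrite ler_nat.
- by move: t1; rewrite natrD.
- by move=> h1 h2; apply: (Hmany lW1); rewrite -(ler_nat R) ?natrM.
Qed.

End Independent.

Lemma no_large_independent (f : rel T) :
  (forall v w, f v w -> joined H1 v w) -> (forall v w, joined H0 v w -> f v w) ->
  (forall v, exists w, f v w) ->
  forall W : {set T}, (forall v w, v \in W -> w \in W -> ~~ f v w) -> (#|W| <= n)%N.
Proof.
move=> fH1 fH0 f_tot W Wind; rewrite leqNgt; apply/negP => Wbig.
exact: (independent_absurd fH1 fH0 f_tot Wind Wbig).
Qed.
End Core.

(** * Probability estimates *)

Lemma onem_expn_le (R : realType) (p : R) m : p <= 1 -> (1 - p) ^+ m <= expR (- (m%:R * p)).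
Proof.
move=> p1; rewrite -mulrN expR_natM lerXn2r ?nnegrE ?expR_ge0 ?subr_ge0 //.
exact: expR_ge1Dx.
Qed.

Lemma expRN_nat_le (R : realType) m : expR (- m%:R) <= 2^-1 ^+ m :> R.
Proof.
rewrite -[m%:R]mulr1 -mulrN expR_natM lerXn2r ?nnegrE ?expR_ge0 ?invr_ge0 //.
rewrite expRN lef_pV2 ?posrE ?expR_gt0 //; have := expR_ge1Dx (1 : R); lra.
Qed.

Section Events.
Variables (R : realType) (T : finType) (e : rel T) (k n : nat) (L : R).
Hypotheses (k_gt0 : (0 < k)%N) (e_irr : irreflexive e).
Hypothesis e_reg : forall x, #|[set y | e x y]| = k.
Hypothesis cardT : #|T| = (2 * n)%N.
Hypotheses (expL : expR L = n%:R) (L_ge : 400 <= L) (L_k : 40 * L <= k%:R).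

Local Notation nb := (nb e).
Local Notation Omega := {ffun {set T} -> 'I_3}.

(** A vertex is isolated with probability about [n ^ (- 9 / 10)] in [H0] and at most [n ^ (- 2)] in
    [H1], on either side of the critical [1 / n]. *)
Definition p0 : R := 9 / 10 * L / k%:R.
Definition p1 : R := 2 * L / k%:R.
Local Notation Pr := (@prob R {set T} p0 p1).

Definition H0 (chi : Omega) : {set {set T}} := [set S | nat_of_ord (chi S) == 0%N].
Definition H1 (chi : Omega) : {set {set T}} := [set S | (nat_of_ord (chi S) <= 1)%N].

Let kp : 0 < k%:R :> R. Proof. by rewrite ltr0n. Qed.
Let Lp : 0 < L. Proof. by apply: lt_le_trans L_ge; rewrite ltr0n. Qed.

Lemma p0k : k%:R * p0 = 9 / 10 * L.
Proof. by rewrite /p0 mulrC mulfVK ?lt0r_neq0. Qed.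

Lemma p1k : k%:R * p1 = 2 * L.
Proof. by rewrite /p1 mulrC mulfVK ?lt0r_neq0. Qed.

Lemma p0_ge0 : 0 <= p0.
Proof. by rewrite -(ler_pM2l kp) p0k mulr0; move: Lp; lra. Qed.

Lemma p01 : p0 <= p1.
Proof. by rewrite -(ler_pM2l kp) p0k p1k; move: Lp; lra. Qed.

Lemma p1_small : p1 <= 20^-1.
Proof. by rewrite -(ler_pM2l kp) p1k; move: L_k; lra. Qed.

Lemma p1_le1 : p1 <= 1.
Proof. by have := p1_small; lra. Qed.

Lemma p1_ge0 : 0 <= p1.
Proof. exact: le_trans p0_ge0 p01. Qed.

Lemma H01 chi : H0 chi \subset H1 chi.
Proof. by apply/subsetP => S; rewrite !inE => /eqP->. Qed.

Lemma Pr_tail (Z Y : {set {set T}}) (sigma z : R) (B : pred Omega) : [disjoint Z & Y] ->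
  (forall chi, B chi -> Z \subset H1 chi /\ sigma * z <= sigma * #|Y :&: H0 chi|%:R) ->
  Pr B <= p1 ^+ #|Z| * expR ((expR sigma - 1) * p0 * #|Y|%:R - sigma * z).
Proof.
move=> dZY BZY; apply: le_trans (Pr_chernoff p0_ge0 p01 p1_le1 sigma z dZY).
apply: (Pr_le p0_ge0 p01 p1_le1) => chi /BZY[ZH YH]; apply/andP; split.
  by apply/forall_inP => S /(subsetP ZH); rewrite inE.
suff -> : [set x in Y | nat_of_ord (chi x) == 0%N] = Y :&: H0 chi by [].
by apply/setP => S; rewrite !inE.
Qed.

Local Notation low chi v := (low_degree e L (H0 chi) v).

(** The edges leaving [Vs] from [B] are distinct, independent of [Z], and at least [0.99 * k] per
    vertex. The Chernoff parameter [- 4] gives the rate [0.99 * 0.9 * (15 / 16) - 4 / 50], just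
    above [3 / 4]. *)
Lemma Pr_low (B Vs : {set T}) (Z : {set {set T}}) (P : pred Omega) :
  B \subset Vs -> (forall S, S \in Z -> S \subset Vs) -> (100 * #|Vs| <= k)%N ->
  (forall chi, P chi -> Z \subset H1 chi /\ {in B, forall v, low chi v}) ->
  Pr P <= p1 ^+ #|Z| * expR (- (3 / 4 * #|B|%:R * L)).
Proof.
move=> BV ZV cV PZ.
pose D v := nb v :\: Vs.
pose Y := [set [set v; w] | v in B, w in D v].
have cY : #|Y| = (\sum_(v in B) #|D v|)%N.
  apply: card_edges => v w _; rewrite inE => /andP[wV _].
  by apply: contra wV; exact: subsetP.
have dZY : [disjoint Z & Y].
  rewrite disjoint_subset; apply/subsetP => S SZ; rewrite inE; apply/negP => /imset2P[v w vB].
  rewrite inE => /andP[wV _] eS; case/negP: wV; apply: (subsetP (ZV S SZ)).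
  by rewrite eS set22.
apply: (le_trans (@Pr_tail Z Y (- 4) (#|B|%:R * L / 50) P dZY _)).
  move=> chi /PZ[ZH lowB]; split=> //.
  rewrite !mulNr lerN2 ler_pM2l ?ltr0n //.
  have : (#|Y :&: H0 chi| <= \sum_(v in B) #|[set w in nb v | [set v; w] \in H0 chi]|)%N.
    apply: leq_trans (card_edges_le _ _); apply/subset_leq_card/subsetP => S.
    rewrite inE => /andP[/imset2P[v w vB]]; rewrite inE => /andP[_ wv] -> SH.
    by apply: imset2_f => //; rewrite in_set wv.
  rewrite -(ler_nat R) natr_sum => h; apply: (le_trans h).
  rewrite -mulrA mulrC mulr_natr -sumr_const; apply: ler_sum => v /lowB.
  by rewrite /low_degree => /ltW; set x := _%:R; lra.
rewrite ler_wpM2l ?exprn_ge0 ?p1_ge0 // ler_expR.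
have cY' : 99 * #|B|%:R * k%:R <= 100 * #|Y|%:R :> R.
  rewrite -!natrM ler_nat cY big_distrr /= -mulnA mulnC -mulnA -sum_nat_const.
  apply: leq_sum => v _; have := cardsID Vs (nb v); rewrite (card_nb e_reg) -/(D v).
  have : (#|nb v :&: Vs| <= #|Vs|)%N by rewrite subset_leq_card // subsetIr.
  by move: cV; clear; lia.
have pY : 99 * #|B|%:R * (9 / 10 * L) <= 100 * (p0 * #|Y|%:R).
  rewrite -p0k; have := ler_wpM2l p0_ge0 cY'; lra.
have e4 : expR (- 4) <= 16^-1 :> R.
  by apply: le_trans (expRN_nat_le R 4) _; rewrite !exprS expr0; lra.
have := ler_wpM2r (mulr_ge0 p0_ge0 (ler0n R #|Y|)) e4.
move: pY; set y := p0 * _; rewrite -[in X in _ -> X]mulrA -/y.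
have BL : 0 <= #|B|%:R * L by rewrite mulr_ge0 ?ler0n ?ltW.
by move: BL; lra.
Qed.

Lemma card_inner W : (mono_in e W <= 2 * #|inner e W|)%N.
Proof.
pose P := [set x : T * T | (x.1 \in W) && (x.2 \in nb x.1 :&: W)].
have -> : mono_in e W = #|P|.
  rewrite (card_pairs W (fun v => nb v :&: W)); apply: eq_bigr => v vW; apply: eq_card => w.
  by rewrite !inE vW; case: (w \in W).
have EP : [set [set x.1; x.2] | x in P] \subset inner e W.
  apply/subsetP => S /imsetP[[v w]]; rewrite in_set /= => /andP[vW wW] ->.
  exact: imset2_f.
apply: (@leq_trans (2 * #|[set [set x.1; x.2] | x in P]|)); last first.
  by rewrite leq_mul2l subset_leq_card.
rewrite -sum1_card (partition_big_imset (fun x : T * T => [set x.1; x.2])) /= mulnC -sum_nat_const.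
apply: leq_sum => S /imsetP[[v w] _ ->] /=; rewrite sum1_card.
apply: (@leq_trans #|[set (v, w); (w, v)]|); last by rewrite cards2; case: eqP.
apply/subset_leq_card/subsetP => [[a b]]; rewrite unfold_in /= => /andP[_ /eqP eS].
have av : a \in [set v; w] by rewrite -eS set21.
have bv : b \in [set v; w] by rewrite -eS set22.
have va : v \in [set a; b] by rewrite eS set21.
have wa : w \in [set a; b] by rewrite eS set22.
move: av bv va wa.
rewrite !inE !xpair_eqE (eq_sym v a) (eq_sym v b) (eq_sym w a) (eq_sym w b).
by case: (a == v); case: (a == w); case: (b == v); case: (b == w).
Qed.

Lemma cardT_real : (2 * n)%:R = 2 * expR L :> R.
Proof. by rewrite natrM expL. Qed.

(** All [2 ^ (2 * n)] sets can be afforded here: more than [4 * n * k / L] edges inside [W] all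
    avoid [H0] with probability at most [exp (- 3 * n)]. *)
Lemma Pr_large_empty_inner :
  Pr (fun chi => [exists W : {set T}, (inner e W :&: H0 chi == set0) &&
        (8 * (n * k)%:R < (mono_in e W)%:R * L)]) <= expR (- n%:R).
Proof.
apply: (le_trans (@Pr_union R _ _ _ p0_ge0 p01 p1_le1 _
  [pred W : {set T} | 8 * (n * k)%:R < (mono_in e W)%:R * L] _
  (fun W chi => [forall S in inner e W, nat_of_ord (chi S) != 0%N]) _)).
  move=> chi /existsP[W /andP[/eqP W0 hW]]; exists W => //.
  apply/forall_inP => S SW; apply/negP => S0.
  by move/setP/(_ S): W0; rewrite in_setI SW in_set S0 in_set0.
apply: (@le_trans _ _ (\sum_(W : {set T}) expR (- (3 * n%:R)))).
  rewrite big_mkcond; apply: ler_sum => W _; case: ifP => [|_]; last exact: expR_ge0.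
  rewrite /= => hW; rewrite Pr_avoid.
  apply: (le_trans (onem_expn_le _ (le_trans p01 p1_le1))); rewrite ler_expR lerN2.
  rewrite -(ler_pM2l kp) [k%:R * (_ * p0)]mulrCA p0k.
  have := card_inner W; rewrite -(ler_nat R) natrM => h.
  have := ler_wpM2r (ltW Lp) h; move: hW; rewrite natrM.
  have : 0 <= n%:R * k%:R :> R by rewrite mulr_ge0 ?ler0n.
  by lra.
rewrite sumr_const -[X in X <= _]mulr_natl.
have -> : #|{: {set T}}| = (2 ^ (2 * n))%N by rewrite -cardsT -powersetT card_powerset cardsT cardT.
have h2 : (2 ^ (2 * n))%:R <= expR (2 * n%:R) :> R.
  rewrite natrX -natrM -[(2 * n)%:R]mulr1 expR_natM lerXn2r ?nnegrE ?expR_ge0 ?ler0n //.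
  by have := expR_ge1Dx (1 : R); lra.
apply: (le_trans (ler_wpM2r (expR_ge0 _) h2)); rewrite -expRD ler_expR.
by lra.
Qed.

Lemma Pr_isolated1 :
  Pr (fun chi => [exists v, [forall w, ~~ joined e (H1 chi) v w]]) <= 2 * expR (- L).
Proof.
apply: (le_trans (@Pr_union R _ _ _ p0_ge0 p01 p1_le1 _ xpredT _
  (fun v chi => [forall S in [set [set v; w] | w in nb v], (1 < nat_of_ord (chi S))%N]) _)).
  move=> chi /existsP[v /forallP hv]; exists v => //; apply/forall_inP => S /imsetP[w wv ->].
  by have := hv w; rewrite /joined; move: wv; rewrite !inE => -> /=; rewrite -ltnNge.
apply: (@le_trans _ _ (\sum_(v : T) expR (- (2 * L)))).
  apply: ler_sum => v _; rewrite Pr_avoid1 card_star ?inE ?e_irr // (card_nb e_reg).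
  by apply: (le_trans (onem_expn_le _ p1_le1)); rewrite p1k.
rewrite sumr_const -[X in X <= _]mulr_natl.
have -> : #|T|%:R = 2 * expR L :> R by rewrite -cardT_real -cardT.
by rewrite -mulrA -expRD ler_pM2l ?ltr0n // ler_expR; lra.
Qed.

(** Markov's inequality: the expected number is at most [2 * n * n ^ (- 3 / 4)]. *)
Lemma Pr_many_low (X : R) : 0 < X ->
  Pr (fun chi => X < #|[set v | low chi v]|%:R) <= 2 / X * expR (L / 4).
Proof.
move=> Xp.
apply: (le_trans (Pr_markov p0_ge0 p01 p1_le1
   (f := fun chi => X^-1 * #|[set v | low chi v]|%:R) _ _)).
- by move=> chi; rewrite mulr_ge0 ?ler0n ?invr_ge0 ?ltW.
- by move=> chi /ltW h; rewrite mulrC ler_pdivlMr // mul1r.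
under eq_bigr do rewrite mulrCA.
rewrite -mulr_sumr [2 / X]mulrC -mulrA ler_wpM2l ?invr_ge0 ?(ltW Xp) //.
have -> : \sum_(chi : Omega) weight p0 p1 chi * #|[set v | low chi v]|%:R
   = \sum_v Pr (fun chi => low chi v).
  rewrite /prob; under [RHS]eq_bigr do rewrite big_mkcond.
  rewrite exchange_big /=; apply: eq_bigr => chi _.
  rewrite -sum1_card natr_sum mulr_sumr mulr1 big_mkcond; apply: eq_bigr => v _.
  by rewrite inE; case: ifP.
apply: (@le_trans _ _ (\sum_(v : T) expR (- (3 / 4 * L)))).
  apply: ler_sum => v _.
  apply: (le_trans (@Pr_low [set v] [set v] set0 _ _ _ _ _)) => //.
  - by move=> S; rewrite inE.
  - rewrite cards1 muln1 -(ler_nat R); apply: le_trans L_k; move: L_ge; lra.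
  - by move=> chi lv; split=> [|w /set1P->//]; rewrite sub0set.
  - by rewrite cards0 expr0 mul1r cards1 mulr1.
rewrite sumr_const -[X in X <= _]mulr_natl.
have -> : #|T|%:R = 2 * expR L :> R by rewrite -cardT_real -cardT.
by rewrite -mulrA -expRD ler_pM2l ?ltr0n // ler_expR; lra.
Qed.

(* Second moment method: isolation of distinct vertices is nearly independent. *)
Lemma Pr_no_isolated0 :
  Pr (fun chi => [forall v, exists w, joined e (H0 chi) v w]) <= expR (- (L / 20)) + 2 * p0.
Proof.
pose q : R := (1 - p0) ^+ k.
pose iso (v : T) : pred Omega :=
  fun chi => [forall S in [set [set v; w] | w in nb v], nat_of_ord (chi S) != 0%N].
pose N (chi : Omega) : R := \sum_v (iso v chi)%:R.
have p0s : p0 <= 20^-1 := le_trans p01 p1_small.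
have q0 : 0 < q by rewrite exprn_gt0 //; move: p0s; lra.
pose mu : R := (2 * n)%:R * q.
have n0 : 0 < n%:R :> R by rewrite -expL expR_gt0.
have mu0 : 0 < mu by rewrite mulr_gt0 // natrM mulr_gt0.
have PrE (B : pred Omega) : Pr B = \sum_chi weight p0 p1 chi * (B chi)%:R.
  by rewrite /prob big_mkcond; apply: eq_bigr => chi _; case: (B chi); rewrite ?mulr1 ?mulr0.
have cst v : #|[set [set v; w] | w in nb v]| = k.
  by rewrite card_star ?inE ?e_irr // (card_nb e_reg).
have EN : \sum_chi weight p0 p1 chi * N chi = mu.
  rewrite /N; under eq_bigr do rewrite mulr_sumr.
  rewrite exchange_big /= /mu -cardT mulr_natl -sumr_const; apply: eq_bigr => v _.
  by rewrite -PrE Pr_avoid cst.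
have EN2 : \sum_chi weight p0 p1 chi * N chi ^+ 2 <= mu + mu ^+ 2 * (1 - p0)^-1.
  rewrite /N; under eq_bigr do rewrite expr2 mulr_suml mulr_sumr.
  rewrite exchange_big /=.
  have -> : mu + mu ^+ 2 * (1 - p0)^-1 = \sum_(v : T) (q + (2 * n)%:R * (q ^+ 2 * (1 - p0)^-1)).
    by rewrite sumr_const cardT -mulr_natl /mu; ring.
  apply: ler_sum => v _.
  under eq_bigr do rewrite mulr_sumr mulr_sumr.
  rewrite exchange_big /= (bigD1 v) //= lerD //.
    have -> : q = Pr (iso v) by rewrite Pr_avoid cst.
    rewrite PrE; apply: ler_sum => chi _; case: (iso v chi); rewrite ?mulr1 ?mulr0 //.
  rewrite -[in leRHS]cardT mulr_natl -sumr_const big_mkcond /=; apply: ler_sum => w _.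
  have pos : 0 <= q ^+ 2 * (1 - p0)^-1.
    by rewrite divr_ge0 ?exprn_ge0 ?(ltW q0) //; move: p0s; lra.
  case: ifP => // wv.
  have -> : \sum_i weight p0 p1 i * ((iso v i)%:R * (iso w i)%:R)
     = Pr (fun chi => [forall S in [set [set v; w'] | w' in nb v] :|: [set [set w; w'] | w' in nb w],
            nat_of_ord (chi S) != 0%N]).
    rewrite PrE; apply: eq_bigr => chi _; congr (_ * _); rewrite -natrM mulnb; congr (_%:R : R).
    congr nat_of_bool; apply/andP/forall_inP => [[/forall_inP h1 /forall_inP h2] S|h].
      by rewrite inE => /orP[/h1|/h2].
    by split; apply/forall_inP => S Sv; apply: h; rewrite inE Sv ?orbT.
  rewrite Pr_avoid.
  have p0n : 1 - p0 != 0 by apply: lt0r_neq0; move: p0s; lra.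
  have k2 : (0 < 2 * k)%N by rewrite muln_gt0.
  have -> : q ^+ 2 * (1 - p0)^-1 = (1 - p0) ^+ (2 * k).-1.
    by rewrite /q -exprM mulnC -[X in _ ^+ X * _](prednK k2) exprSr mulfK.
  rewrite ler_wiXn2l //; [by move: p0s; lra|by have := p0_ge0; lra|].
  rewrite cardsU !cst.
  (* The stars of distinct vertices share at most one edge, so their union has at least [2 * k - 1]
     edges. *)
  set c := (X in (_ - X)%N); suff : (c <= 1)%N by clear; lia.
  rewrite /c -(cards1 [set v; w]); apply/subset_leq_card/subsetP => S.
  rewrite inE => /andP[/imsetP[a _ ->] /imsetP[b _]] eS.
  have : w \in [set v; a] by rewrite eS set21.
  by rewrite !inE (negbTE wv) /= => /eqP->.
(* Chebyshev: without isolated vertices [N chi = 0], and the squared relative deviation equals 1. *)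
apply: (@le_trans _ _ (\sum_chi weight p0 p1 chi * (1 - N chi / mu) ^+ 2)).
  apply: (Pr_markov p0_ge0 p01 p1_le1) => chi; first exact: sqr_ge0.
  move=> /forallP h; rewrite /N big1 ?mul0r ?subr0 ?expr1n // => v _.
  rewrite /iso; case: forall_inP => // ho; have /existsP[w] := h v.
  rewrite /joined inE => /andP[vw]; rewrite (negbTE (ho _ _)) //.
  by apply: imset_f; rewrite inE.
have W1 : \sum_(chi : Omega) weight p0 p1 chi = 1.
  have := Pr_avoid p0 p1 (set0 : {set {set T}}); rewrite cards0 expr0 => <-.
  by rewrite /prob; apply: eq_bigl => chi; symmetry; apply/forall_inP => S; rewrite inE.
have -> : \sum_chi weight p0 p1 chi * (1 - N chi / mu) ^+ 2
  = \sum_(chi : Omega) weight p0 p1 chi - 2 * mu^-1 * (\sum_chi weight p0 p1 chi * N chi)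
    + (mu ^+ 2)^-1 * \sum_chi weight p0 p1 chi * N chi ^+ 2.
  rewrite !mulr_sumr -sumrB -big_split /=; apply: eq_bigr => chi _.
  by field; rewrite lt0r_neq0.
rewrite W1 EN.
have h : (mu ^+ 2)^-1 * \sum_chi weight p0 p1 chi * N chi ^+ 2 <= mu^-1 + (1 - p0)^-1.
  apply: (le_trans (ler_wpM2l _ EN2)); first by rewrite invr_ge0 exprn_ge0 ?ltW.
  rewrite le_eqVlt; apply/orP; left; apply/eqP; field.
  by apply/andP; split; apply: lt0r_neq0 => //; move: p0s; lra.
have h2 : (1 - p0)^-1 <= 1 + 2 * p0.
  rewrite -[leLHS]mul1r ler_pdivrMr; last by move: p0s; lra.
  by have := p0_ge0; move: p0s; nra.
have h3 : mu^-1 <= expR (- (L / 20)).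
  rewrite expRN lef_pV2 ?posrE ?expR_gt0 //.
  (* For [p0 <= 1 / 20] one has [1 - p0 >= exp (- 19 / 18 * p0)], and [19 / 18 * 9 / 10 = 19 / 20];
     so [mu] is at least [n ^ (1 / 20)]. *)
  have q1 : expR (- (19 / 20 * L)) <= q.
    have -> : - (19 / 20 * L) = k%:R * (- (19 / 18 * p0)).
      by rewrite mulrN mulrCA p0k; field.
    rewrite expR_natM lerXn2r ?nnegrE ?expR_ge0 //; first by move: p0s; lra.
    rewrite expRN -[leRHS]invrK lef_pV2 ?posrE ?expR_gt0 ?invr_gt0 //; last by move: p0s; lra.
    apply: le_trans (expR_ge1Dx _).
    rewrite -[leLHS]mul1r ler_pdivrMr; last by move: p0s; lra.
    by have := p0_ge0; move: p0s; nra.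
  rewrite /mu cardT_real; apply: (@le_trans _ _ (2 * expR L * expR (- (19 / 20 * L)))).
    rewrite -mulrA -expRD; have -> : L + - (19 / 20 * L) = L / 20 by field.
    by have := expR_ge0 (L / 20); lra.
  by rewrite ler_wpM2l // mulr_ge0 ?expR_ge0.
rewrite -[2 * mu^-1 * mu]mulrA mulVf ?lt0r_neq0 // mulr1.
by move: h h2 h3; lra.
Qed.

End Events.

(** * Union bounds over light cuts *)

Lemma sum_expRN_le1 (R : realType) J : \sum_(j < J) expR (- j.+1%:R) <= 1 :> R.
Proof.
apply: (@le_trans _ _ (1 - 2^-1 ^+ J)); last by rewrite gerBl exprn_ge0 // invr_ge0.
elim: J => [|J IH]; first by rewrite big_ord0 expr0 subrr.
rewrite big_ord_recr /=; apply: (le_trans (lerD IH (expRN_nat_le _ _))).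
rewrite exprS; set x := _ ^+ J; lra.
Qed.

Lemma natr_le_expR (R : realType) m : m%:R <= expR m%:R :> R.
Proof. by apply: le_trans (expR_ge1Dx _); rewrite lerDr. Qed.

Lemma natr_exp2_le (R : realType) m : (2 ^ m)%:R <= expR m%:R :> R.
Proof.
rewrite natrX -[X in expR X]mulr1 expR_natM lerXn2r ?nnegrE ?expR_ge0 //.
by have := expR_ge1Dx (1 : R); lra.
Qed.

Lemma sum_set_expR (R : realType) (T : finType) (t : R) : 0 <= t ->
  \sum_(F : {set T}) t ^+ #|F| <= expR (#|T|%:R * t).
Proof.
move=> t0.
have -> : \sum_(F : {set T}) t ^+ #|F| = \prod_(v : T) (t + 1).
  rewrite bigA_distr; apply: eq_bigr => F _; rewrite -prodr_const big_mkcond /=.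
  by apply: eq_bigr => v _.
rewrite prodr_const expR_natM lerXn2r ?nnegrE ?expR_ge0 ?addr_ge0 //.
by rewrite addrC expR_ge1Dx.
Qed.

Lemma many_inner_arith (R : realFieldType) (L x A j lv p0i N k : R) : 0 < L -> 0 < k ->
  50 * A <= L -> k <= x -> lv * (2 * k) <= 3 * x -> j = lv + 1 -> 0 <= A -> 0 <= lv ->
  9 / 10 * L * x <= k * (2 * p0i) -> 0 <= p0i -> N <= 2^-1 ->
  k * ((N - 1) * p0i + x * L / (8 * k)) <= k * (- (L / 50) - A * j).
Proof.
move=> Lp kp AL kx lx -> A0 lv0 h p00 N2.
have -> : k * ((N - 1) * p0i + x * L / (8 * k)) = (N - 1) * (k * p0i) + x * L / 8.
  by field; rewrite lt0r_neq0.
have kA : A * (lv * k) <= L / 50 * (3 / 2 * x).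
  apply: ler_pM => //; [by rewrite mulr_ge0 // ltW | lra | lra].
have kA' : A * k <= L / 50 * x by apply: ler_pM => //; [exact: ltW | lra].
have kL : L * k <= L * x by rewrite ler_pM2l.
have Np : (N - 1) * (k * p0i) <= - 2^-1 * (k * p0i).
  by rewrite ler_wpM2r ?mulr_ge0 // ?(ltW kp) //; lra.
have Lk : 0 <= L * k by rewrite mulr_ge0 ?ltW.
move: kA kA' kL Np h Lk; clear; lra.
Qed.

Lemma sparse_arith (R : realFieldType) (L x A lv pt a b E r : R) : 0 < L -> 50 * A <= L ->
  0 <= A -> 0 <= lv -> 1 <= a -> 0 <= b -> 0 <= pt -> E * pt <= 3 * a * (9 / 10 * L) -> 3 * r <= E ->
  (r - 1) * pt - 1200 * ((50 * (a + b) + lv) * L / 10000)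
   <= - L - A * (lv + 1) + (- L * a - L * b).
Proof.
move=> Lp AL A0 lv0 a1 b0 pt0 hE hr.
have h1 : 3 * (r * pt) <= 3 * a * (9 / 10 * L).
  by rewrite mulrA; apply: le_trans hE; rewrite ler_wpM2r.
have h2 : 50 * A * lv <= L * lv by rewrite ler_wpM2r.
have h3 : L <= L * a by rewrite ler_peMr // ltW.
have h4 : 0 <= L * b by rewrite mulr_ge0 // ltW.
have h5 : 0 <= L * lv by rewrite mulr_ge0 // ltW.
move: h1 h2 h3 h4 h5 pt0 AL A0; clear; lra.
Qed.

Section Events.
Variables (R : realType) (T : finType) (e : rel T) (k n E J : nat) (L : R).
Hypotheses (k_gt0 : (0 < k)%N) (e_sym : symmetric e).
Hypothesis e_reg : forall x, #|[set y | e x y]| = k.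
Hypothesis cardT : #|T| = (2 * n)%N.
Hypotheses (expL : expR L = n%:R) (L_ge : 400 <= L) (L_k : 40 * L <= k%:R).
Hypotheses (E_ge3 : (3 <= E)%N) (E_ge : 3 * expR 1200 <= E%:R :> R).
Hypothesis J1 : (100 * (10 * J * k + 400 * J * #|T|) <= k * k)%N.
Hypothesis J2 : (20 * E * J <= k)%N.
Hypothesis J3 : (32 * n)%:R < J%:R * L.

Local Notation nb := (nb e).
Local Notation mono_deg := (mono_deg e).
Local Notation mono := (mono e).
Local Notation level := (level e k).
Local Notation light := (light e k n E L).
Local Notation p0 := (@p0 R k L).
Local Notation p1 := (@p1 R k L).
Local Notation Pr := (@prob R {set T} p0 p1).
Local Notation q := (sample_size T k).

(* Up to the factor [expR (sample_size T k)], there are at most [expR ((entropy - 1) * j)]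
   light cuts of level [j - 1]; the extra 1 makes the union bound over [j] summable. *)
Definition entropy : nat := (200 + 41 * E).+1.
Hypothesis L_entropy : 50 * entropy%:R <= L.

Let kp : 0 < k%:R :> R. Proof. by rewrite ltr0n. Qed.
Let Lp : 0 < L. Proof. by apply: lt_le_trans L_ge; rewrite ltr0n. Qed.

Lemma level_lt W : light W -> (level W < J)%N.
Proof.
move=> /andP[_ mW].
have lev : (level W * (2 * k) <= mono W)%N by exact: leq_trunc_div.
rewrite -(ltr_nat R) -(ltr_pM2r Lp); apply: le_lt_trans J3.
rewrite -(ler_pM2r kp); move: lev; rewrite -(ler_nat R) !natrM => lev.
have := ler_wpM2r (ltW Lp) lev; move: mW; rewrite natrM; lra.
Qed.

Lemma card_light j : (j < J)%N ->
  #|[set W | light W && (level W == j)]|%:R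
    <= expR q%:R * expR ((200 + 41 * E)%N%:R * j.+1%:R) :> R.
Proof.
move=> jJ.
have c : (#|[set W | light W && (level W == j)]| <= 200 * j.+1 * 2 ^ q * 2 ^ (41 * E * j.+1))%N.
  have h1 : (100 * (10 * j.+1 * k + 400 * j.+1 * #|T|) <= k * k)%N.
    apply: leq_trans J1; rewrite leq_mul2l /= leq_add // leq_mul2r; apply/orP; right;
    by rewrite leq_mul2l jJ orbT.
  have h2 : (20 * E * j.+1 <= k)%N by apply: leq_trans J2; rewrite leq_mul2l jJ orbT.
  apply: leq_trans (card_tame k_gt0 e_sym e_reg (ltn_trans _ E_ge3) (ltn0Sn j) h1 h2) => //.
  apply/subset_leq_card/subsetP => W; rewrite !in_set => /andP[/andP[-> _] /eqP lj] /=.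
  have := ltn_ceil (mono W) (_ : (0 < 2 * k)%N); rewrite -/(level W) lj muln_gt0 k_gt0 => /(_ isT).
  by move=> /ltnW; rewrite mulnCA mulnA.
apply: (@le_trans _ _ (200 * j.+1 * 2 ^ q * 2 ^ (41 * E * j.+1))%N%:R); first by rewrite ler_nat.
rewrite natrD mulrDl -natrM -natrM expRD mulrA [expR q%:R * _]mulrC natrM.
rewrite [(200 * _ * _)%N%:R]natrM.
by rewrite !ler_pM ?mulr_ge0 ?ler0n ?natr_exp2_le // natr_le_expR.
Qed.

Lemma sum_light (g : {set T} -> R) (D : R) : 0 <= D ->
  (forall W, light W -> g W <= D * expR (- (entropy%:R * (level W).+1%:R))) ->
  \sum_(W | light W) g W <= D * expR q%:R.
Proof.
move=> D0 gD.
pose h (j : nat) : R := D * expR (- (entropy%:R * j.+1%:R)).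
have h0 j : 0 <= h j by rewrite mulr_ge0 ?expR_ge0.
apply: (@le_trans _ _ (\sum_(W | light W) \sum_(j < J) (if level W == j then h j else 0))).
  apply: ler_sum => W lW; apply: (le_trans (gD W lW)).
  rewrite (bigD1 (Ordinal (level_lt lW))) //= eqxx lerDl sumr_ge0 // => j _.
  by case: ifP.
rewrite exchange_big /=.
apply: (@le_trans _ _ (\sum_(j < J) D * expR q%:R * expR (- j.+1%:R))); last first.
  rewrite -mulr_sumr ler_piMr ?sum_expRN_le1 // mulr_ge0 ?expR_ge0 //.
apply: ler_sum => j _; rewrite -big_mkcondr /= sumr_const -[X in X <= _]mulr_natl.
have := card_light (ltn_ord j).
have -> : #|[set W | light W && (level W == j)]| = #|(fun W => light W && (level W == j))|.
  by apply: eq_card => W; rewrite inE.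
move=> c; apply: (le_trans (ler_wpM2r (h0 j) c)).
rewrite /h mulrCA -!mulrA ler_wpM2l // ler_wpM2l ?expR_ge0 //.
rewrite -expRD ler_expR /entropy.
set a := (200 + 41 * E)%N%:R; set b := j.+1%:R; rewrite -[X in - (X * _)]natr1 -/a; lra.
Qed.

(** With [x] for [mono_in e W], the expected number of [H0]-edges inside is at least
    [0.45 * x * L / k], so falling below [x * L / (8 * k)] costs [exp (- x * L / (10 * k))]. The
    bounds [x >= k] and [3 * x >= mono W] turn this into a gain in both [L] and the level. *)
Lemma Pr_few_inner :
  Pr (fun chi => [exists W : {set T}, [&& light W, (k <= mono_in e W)%N,
    (mono W <= 3 * mono_in e W)%N &
    8 * k%:R * #|inner e W :&: H0 chi|%:R < (mono_in e W)%:R * L]])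
  <= expR (- (L / 50)) * expR q%:R.
Proof.
pose P W := light W && ((k <= mono_in e W)%N && (mono W <= 3 * mono_in e W)%N).
have P0 := p0_ge0 k_gt0 L_ge; have P01 := p01 k_gt0 L_ge; have P1 := p1_le1 k_gt0 L_k.
apply: (le_trans (@Pr_union R _ _ _ P0 P01 P1 _ P _
  (fun W chi => 8 * k%:R * #|inner e W :&: H0 chi|%:R < (mono_in e W)%:R * L) _)).
  by move=> chi /existsP[W /and4P[h1 h2 h3 h4]]; exists W; rewrite // /P h1 h2 h3.
rewrite /P big_mkcondr /=; apply: sum_light; first exact: expR_ge0.
move=> W lW; case: ifP => [/andP[kx mx]|_]; last by rewrite mulr_ge0 ?expR_ge0.
apply: (le_trans (@Pr_tail R T k L k_gt0 L_ge L_k set0 (inner e W) (- 1)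
  ((mono_in e W)%:R * L / (8 * k%:R)) _ _ _)).
- by rewrite -setI_eq0 set0I.
- move=> chi /ltW h; split; first exact: sub0set.
  by rewrite !mulN1r lerN2 ler_pdivlMr ?mulr_gt0 // mulrC.
rewrite cards0 expr0 mul1r -expRD ler_expR -(ler_pM2l kp) mulN1r opprK -[_ * p0 * _]mulrA.
have lev : (level W * (2 * k) <= mono W)%N by exact: leq_trunc_div.
apply: (many_inner_arith (lv := (level W)%:R)) => //.
- by rewrite ler_nat.
- by have := leq_trans lev mx; rewrite -(ler_nat R) !natrM.
- by rewrite natr1.
- have := card_inner e W; rewrite -(ler_nat R) natrM => /(ler_wpM2l P0).
  move=> /(ler_wpM2l (ltW kp)); rewrite mulrA (p0k L k_gt0) => h; apply: (le_trans h).
  by rewrite le_eqVlt; apply/orP; left; apply/eqP; ring.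
- by rewrite mulr_ge0.
- by have := expRN_nat_le R 1; rewrite expr1.
Qed.

Lemma card_touch_le W (Fa Fb : {set T}) :
  (forall v, v \in Fa -> E * mono_deg W v <= 2 * k)%N -> (E * #|Fb| <= k)%N ->
  (E * #|touch e W Fa Fb| <= 3 * #|Fa| * k)%N.
Proof.
move=> ha hb; apply: (@leq_trans (E * \sum_(v in Fa) (mono_deg W v + #|Fb|))).
  rewrite leq_mul2l; apply/orP; right; apply: (leq_trans (card_edges_le _ _)).
  apply: leq_sum => v _; apply: leq_cardU; apply/subsetP => w; rewrite !inE.
  by case: (w \in Fb); rewrite ?orbT ?orbF //= => /andP[-> ->].
rewrite big_distrr /= mulnC mulnA -[(k * 3)%N]mulnC mulnC -sum_nat_const.
apply: leq_sum => v /ha h; rewrite mulnDr; apply: (leq_trans (leq_add h hb)).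
by rewrite -mulSnr.
Qed.

(** Choosing [Fa] and [Fb] costs about [exp L] per vertex. With parameter 1200 the threshold is
    worth [6 * L] per vertex and [0.12 * L] per unit of level; [E >= 3 * exp 1200] keeps the
    exponential moment of the few touched edges at [0.9 * L] per vertex of [Fa]. *)
Lemma Pr_dense_touch :
  Pr (fun chi => [exists W : {set T}, exists Fa : {set T}, exists Fb : {set T},
    [&& light W, [forall v in Fa, (E * mono_deg W v <= 2 * k)%N], (E * #|Fb| <= k)%N &
     50 * (#|Fa| + #|Fb|)%:R * L + (level W)%:R * L
       < #|touch e W Fa Fb :&: H0 chi|%:R * 10000]])
  <= expR (4 - L) * expR q%:R.
Proof.
have P0 := p0_ge0 k_gt0 L_ge; have P01 := p01 k_gt0 L_ge; have P1 := p1_le1 k_gt0 L_k.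
pose I := ({set T} * ({set T} * {set T}))%type.
pose P (i : I) := [&& light i.1, [forall v in i.2.1, (E * mono_deg i.1 v <= 2 * k)%N],
  (E * #|i.2.2| <= k)%N & i.2.1 != set0].
apply: (le_trans (@Pr_union R _ _ _ P0 P01 P1 _ P _
  (fun i chi => 50 * (#|i.2.1| + #|i.2.2|)%:R * L + (level i.1)%:R * L
       < #|touch e i.1 i.2.1 i.2.2 :&: H0 chi|%:R * 10000) _)).
  move=> chi /existsP[W /existsP[Fa /existsP[Fb /and4P[h1 h2 h3 h4]]]].
  (* An empty [Fa] touches no edge and cannot exceed the threshold. A nonempty one leaves a spare
     factor [expR (- L)]. *)
  exists (W, (Fa, Fb)) => //; rewrite /P /= h1 h2 h3 /=; apply: contraL h4 => /eqP->.
  rewrite -leNgt (_ : touch _ _ _ _ = set0); last first.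
    apply/setP => S; rewrite in_set0; apply/negP => /imset2P[v w]; by rewrite in_set0.
  rewrite set0I cards0 mul0r addr_ge0 ?mulr_ge0 ?ler0n ?(ltW Lp) //.
pose t (F : {set T}) : R := expR (- L) ^+ #|F|.
have t0 F : 0 <= t F by rewrite exprn_ge0 ?expR_ge0.
pose G W : R := expR (- L) * expR (- (entropy%:R * (level W).+1%:R)).
have G0 W : 0 <= G W by rewrite mulr_ge0 ?expR_ge0.
apply: (@le_trans _ _ (\sum_(i : I | light i.1) G i.1 * (t i.2.1 * t i.2.2))).
  rewrite big_mkcond [leRHS]big_mkcond; apply: ler_sum => -[W [Fa Fb]] _ /=.
  case: ifP => [/and4P[/= lW /forall_inP ha hb Fa0]|_]; last first.
    by case: ifP => // _; exact: mulr_ge0 (G0 W) (mulr_ge0 (t0 _) (t0 _)).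
  rewrite lW.
  apply: (le_trans (@Pr_tail R T k L k_gt0 L_ge L_k set0 (touch e W Fa Fb) 1200
    ((50 * (#|Fa|%:R + #|Fb|%:R) + (level W)%:R) * L / 10000) _ _ _)).
  - by rewrite -setI_eq0 set0I.
  - move=> chi /= /ltW h; split; first exact: sub0set.
    rewrite ler_pM2l ?ltr0n // ler_pdivrMr ?ltr0n //; apply: le_trans h.
    by rewrite natrD mulrDl.
  rewrite cards0 expr0 mul1r /G /t -!expR_natM -!expRD ler_expR -[_ * p0 * _]mulrA.
  have -> : #|Fa|%:R * - L + #|Fb|%:R * - L = - L * #|Fa|%:R - L * #|Fb|%:R by ring.
  rewrite -[(level W).+1%:R]natr1.
  apply: sparse_arith E_ge => //.
  - by rewrite ler1n card_gt0.
  - by rewrite mulr_ge0.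
  have := card_touch_le ha hb; rewrite -(ler_nat R) !natrM => h.
  have := ler_wpM2l P0 h; rewrite -(p0k L k_gt0); lra.
rewrite (eq_bigl (fun i : I => light i.1 && true)); last by move=> i; rewrite andbT.
rewrite -(pair_big_dep light (fun _ _ => true) (fun W i => G W * (t i.1 * t i.2))) /=.
(* The sum is [(1 + 1 / n) ^ (2 * n)]. *)
have tE : \sum_(F : {set T}) t F <= expR 2.
  apply: (le_trans (sum_set_expR T (expR_ge0 (- L)))).
  by rewrite cardT natrM -expL -mulrA -expRD subrr expR0 mulr1.
have tt : \sum_(i : {set T} * {set T}) t i.1 * t i.2 <= expR 4.
  rewrite -(pair_bigA _ (fun F F' => t F * t F')) /=.
  under eq_bigr do rewrite -mulr_sumr.
  rewrite -mulr_suml; have -> : 4 = 2 + 2 :> R by lra.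
  by rewrite expRD ler_pM // sumr_ge0.
under eq_bigr do rewrite -mulr_sumr.
rewrite -mulr_suml mulrC expRD -mulrA ler_pM ?sumr_ge0 //; first by move=> *; rewrite mulr_ge0.
by apply: sum_light; rewrite ?expR_ge0.
Qed.
End Events.

(** * Low-degree vertices joined by short paths *)

Lemma path_rev_belast (T : eqType) (r : rel T) v p : symmetric r ->
  path r v p -> [/\ path r (last v p) (rev (belast v p)), last (last v p) (rev (belast v p)) = v
                 & size (rev (belast v p)) = size p].
Proof.
move=> r_sym vp; rewrite size_rev size_belast; split=> //.
  by rewrite rev_path; apply: sub_path vp => x y; rewrite r_sym.
by case: p {vp} => //= w p; rewrite rev_cons last_rcons.
Qed.

Section PathEdges.
Variable T : finType.
Definition path_edges (v : T) p : seq {set T} := pairmap (fun x y => [set x; y]) v p.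

Lemma path_edges_sub v p S : S \in path_edges v p -> S \subset [set x in v :: p].
Proof.
elim: p v => //= w p IH v; rewrite inE => /orP[/eqP->|/IH h].
  by apply/subsetP => x; rewrite !inE => /orP[]->; rewrite ?orbT.
by apply: (subset_trans h); apply/subsetP => x; rewrite !inE => ->; rewrite orbT.
Qed.

Lemma path_edges_uniq v p : uniq (v :: p) -> uniq (path_edges v p).
Proof.
elim: p v => //= w p IH v /andP[vp wp]; rewrite (IH w wp) andbT.
apply/negP => /path_edges_sub/subsetP/(_ v); rewrite !inE eqxx => /(_ isT) h.
by move: vp; rewrite inE h.
Qed.

Lemma size_path_edges v p : size (path_edges v p) = size p.
Proof. exact: size_pairmap. Qed.

Lemma path_edges_in (r : rel T) (H : {set {set T}}) v p :
  (forall x y, r x y -> [set x; y] \in H) -> path r v p -> {subset path_edges v p <= H}.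
Proof.
move=> rH; elim: p v => //= w q IH v /andP[vw wq] S.
by rewrite inE => /orP[/eqP->|/(IH w wq)]; first exact: rH.
Qed.

Lemma card_paths (e : rel T) k l v : (forall x, #|[set y | e x y]| = k) ->
  (#|[set p : l.-tuple T | path e v p]| <= k ^ l)%N.
Proof.
move=> e_reg; elim: l v => [|l IH] v.
  by apply: (leq_trans (max_card _)); rewrite card_tuple.
apply: (@leq_trans #|\bigcup_(w in [set y | e v y])
   [set cons_tuple w p | p in [set p : l.-tuple T | path e w p]]|).
  apply/subset_leq_card/subsetP => p; rewrite inE; case/tupleP: p => w p /= /andP[vw wp].
  apply/bigcupP; exists w; rewrite ?inE //.
  by apply/imsetP; exists p; rewrite ?inE //; apply: val_inj.
apply: (leq_trans (card_bigcup_le _ _)).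
rewrite expnS -[X in (X * _)%N](e_reg v) -sum_nat_const; apply: leq_sum => w _.
exact: leq_trans (leq_imset_card _ _) (IH w).
Qed.
End PathEdges.

Section Events.
Variables (R : realType) (T : finType) (e : rel T) (k n : nat) (L : R).
Hypotheses (k_gt0 : (0 < k)%N) (e_sym : symmetric e) (e_irr : irreflexive e).
Hypothesis e_reg : forall x, #|[set y | e x y]| = k.
Hypothesis cardT : #|T| = (2 * n)%N.
Hypotheses (expL : expR L = n%:R) (L_ge : 400 <= L) (L_k : 40 * L <= k%:R).

Local Notation nb := (nb e).
Local Notation mono_deg := (mono_deg e).
Local Notation mono := (mono e).
Local Notation level := (level e k).
Local Notation p0 := (@p0 R k L).
Local Notation p1 := (@p1 R k L).
Local Notation Pr := (@prob R {set T} p0 p1).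
Local Notation Omega := {ffun {set T} -> 'I_3}.
Local Notation low chi v := (low_degree e L (H0 chi) v).

Let kp : 0 < k%:R :> R. Proof. by rewrite ltr0n. Qed.
Let Lp : 0 < L. Proof. by apply: lt_le_trans L_ge; rewrite ltr0n. Qed.
Let P0 := p0_ge0 k_gt0 L_ge.
Let P01 := p01 k_gt0 L_ge.
Let P1 := p1_le1 k_gt0 L_k.
Let P1_ge0 := p1_ge0 k_gt0 L_ge.

(** Lengths 1 to 4 appear as [l.+1] with tuples of that length, which makes the negation of
    [spread_low] a boolean event. *)
Definition close_low (chi : Omega) : bool :=
  [exists l : 'I_4, exists v : T, exists p : l.+1.-tuple T,
    [&& path (joined e (H1 chi)) v p, uniq (v :: p), low chi v & low chi (last v p)]].

Lemma spread_low_close chi : ~~ close_low chi -> spread_low e L (H0 chi) (H1 chi).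
Proof.
move=> /negP ncl v p pp up /andP[sp0 sp4] lv lp; apply: ncl.
have s4 : ((size p).-1 < 4)%N by rewrite prednK.
have sp : size p == (size p).-1.+1 by rewrite prednK.
apply/existsP; exists (Ordinal s4); apply/existsP; exists v; apply/existsP; exists (Tuple sp).
by apply/and4P.
Qed.

Lemma Pr_low_path l v (p : l.+1.-tuple T) : (l < 4)%N -> uniq (v :: p) ->
  Pr (fun chi => [&& path (joined e (H1 chi)) v p, low chi v & low chi (last v p)])
  <= p1 ^+ l.+1 * expR (- (3 / 2 * L)).
Proof.
move=> l4 up.
have ne : last v p != v.
  case/tupleP: p up => w p /=; rewrite inE => /andP[/norP[vw vp] _].
  by apply/eqP => lv; have := mem_last w p; rewrite lv inE (negbTE vw) (negbTE vp).
apply: (le_trans (@Pr_low R T e k L k_gt0 e_reg L_ge L_k [set v; last v p] [set x in v :: p]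
  [set S in path_edges v p] _ _ _ _ _)).
- by rewrite subUset !sub1set !inE eqxx /= -in_cons mem_last.
- by move=> S; rewrite inE; exact: path_edges_sub.
- rewrite -(ler_nat R); apply: (@le_trans _ _ 500%:R).
    rewrite ler_nat; apply: (@leq_trans (100 * 5)); rewrite // leq_mul2l /=.
    have : (#|[set x in v :: p]| <= size (v :: p))%N.
      by rewrite cardsE; exact: card_size.
    by rewrite /= size_tuple => /leq_trans; apply; rewrite ltnS.
  by apply: le_trans L_k; move: L_ge; lra.
- move=> chi /and3P[pp lv lp]; split; last by move=> w /set2P[]->.
  by apply/subsetP => S; rewrite inE; apply: (path_edges_in _ pp) => x y /andP[].
rewrite cardsE (card_uniqP (path_edges_uniq up)) size_path_edges size_tuple.
rewrite cards2 eq_sym ne /= ler_wpM2l ?exprn_ge0 // ler_expR; lra.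
Qed.

(** Each of [2 * n] starting points has at most [k ^ l.+1] paths, each present in [H1] with
    probability [p1 ^ l.+1], and [k * p1 = 2 * L]. Two low-degree ends cost [n ^ (- 3 / 2)], which
    leaves [n ^ (- 1 / 2)] up to powers of [L]. *)
Lemma Pr_close_low : Pr close_low <= 128 * L ^+ 4 * expR (- (L / 2)).
Proof.
apply: (le_trans (@Pr_union R _ _ _ P0 P01 P1 'I_4 xpredT _ (fun l chi => [exists v : T, exists p : l.+1.-tuple T,
    [&& path (joined e (H1 chi)) v p, uniq (v :: p), low chi v & low chi (last v p)]]) _)).
  by move=> chi /existsP[l h]; exists l.
apply: (@le_trans _ _ (\sum_(l < 4) 32 * L ^+ 4 * expR (- (L / 2)))); last first.
  by rewrite sumr_const card_ord -[X in X <= _]mulr_natl !mulrA -natrM.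
apply: ler_sum => l _.
apply: (le_trans (@Pr_union R _ _ _ P0 P01 P1 T xpredT _ (fun v chi => [exists p : l.+1.-tuple T,
    [&& path (joined e (H1 chi)) v p, uniq (v :: p), low chi v & low chi (last v p)]]) _)).
  by move=> chi /existsP[v h]; exists v.
apply: (@le_trans _ _ (\sum_(v : T) 16 * L ^+ 4 * expR (- (3 / 2 * L)))); last first.
  rewrite sumr_const -[X in X <= _]mulr_natl cardT natrM -expL.
  have -> : - (L / 2) = L + - (3 / 2 * L) by field.
  by rewrite expRD; set a := expR L; set b := expR _; lra.
apply: ler_sum => v _.
apply: (le_trans (@Pr_union R _ _ _ P0 P01 P1 (l.+1.-tuple T) (fun p => path e v p && uniq (v :: p)) _
    (fun p chi => [&& path (joined e (H1 chi)) v p, low chi v & low chi (last v p)]) _)).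
  move=> chi /existsP[p /and4P[h1 h2 h3 h4]]; exists p; last by rewrite h1 h3 h4.
  by rewrite h2 andbT; apply: sub_path h1 => x y /andP[].
apply: (@le_trans _ _ (\sum_(p : l.+1.-tuple T | path e v p) p1 ^+ l.+1 * expR (- (3 / 2 * L)))).
  rewrite big_mkcondr /=; apply: ler_sum => p _; case: ifP => [up|_]; first exact: Pr_low_path.
  by rewrite mulr_ge0 ?exprn_ge0 ?expR_ge0.
rewrite sumr_const -[X in X <= _]mulr_natl mulrA ler_wpM2r ?expR_ge0 //.
have c : (#|[pred p : l.+1.-tuple T | path e v p]| <= k ^ l.+1)%N.
  by rewrite -cardsE; exact: card_paths.
apply: (@le_trans _ _ ((k ^ l.+1)%N%:R * p1 ^+ l.+1)).
  by rewrite ler_wpM2r ?exprn_ge0 // ler_nat.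
rewrite natrX -exprMn (p1k L k_gt0).
apply: (@le_trans _ _ ((2 * L) ^+ 4)); last by rewrite exprMn; set x := L ^+ 4; lra.
by rewrite ler_weXn2l //; move: L_ge; lra.
Qed.

(** * Bad vertices of a single cut *)

Section Bad.
Variable W : {set T}.

Local Notation V := ((T * T) * T)%type.
(* The case [t.1.1 = t.2] is allowed and covers monochromatic edges at [t.1.1]. *)
Definition cherry : pred V := fun t => [&& e t.1.1 t.1.2, e t.1.2 t.2 & (t.1.2 \in W) == (t.2 \in W)].
Definition cherry_vertices (t : V) : {set T} := [set t.1.1; t.1.2; t.2].
Definition cherry_edges (t : V) : {set {set T}} := [set [set t.1.1; t.1.2]; [set t.1.2; t.2]].

(** Fix the monochromatic pair [(w, w')] first. The choice [v = w'] yields one edge and weight [p1];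
    the at most [k] other choices yield two edges each. *)
Lemma sum_cherry : \sum_(t | cherry t) p1 ^+ #|cherry_edges t| <= (mono W)%:R * (p1 + k%:R * p1 ^+ 2).
Proof.
pose F (v w w' : T) : R := (v == w')%:R * p1 + p1 ^+ 2.
have F0 v w w' : 0 <= F v w w'.
  by apply: addr_ge0; [exact: mulr_ge0 | exact: exprn_ge0].
apply: (@le_trans _ _ (\sum_(t : V) (if cherry t then F t.1.1 t.1.2 t.2 else 0))).
  rewrite big_mkcond; apply: ler_sum => -[[v w] w'] _ /=; case: ifP => // /and3P[/= vw ww' _].
  rewrite /F /cherry_edges /=; case: eqP => [->|/eqP vw'].
    by rewrite (setUC [set w]) setUid cards1 mul1r expr1 lerDl exprn_ge0.
  rewrite cards2 mul0r add0r; case: eqP => [eS|]; last by [].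
  have : v \in [set w; w'] by rewrite -eS set21.
  rewrite !inE (negbTE vw') orbF => /eqP evw; by move: vw; rewrite evw e_irr.
rewrite -(pair_bigA _ (fun vw w' => if cherry (vw, w') then F vw.1 vw.2 w' else 0)) /=.
rewrite -(pair_bigA _ (fun v w => \sum_w' if cherry ((v, w), w') then F v w w' else 0)) /=.
rewrite exchange_big /= /mono natr_sum mulr_suml; apply: ler_sum => w _.
rewrite exchange_big /=.
have -> : (mono_deg W w)%:R * (p1 + k%:R * p1 ^+ 2)
   = \sum_(w' in [set u in nb w | (u \in W) == (w \in W)]) (p1 + k%:R * p1 ^+ 2).
  by rewrite sumr_const mulr_natl.
rewrite [leRHS]big_mkcond; apply: ler_sum => w' _.
have c0 : 0 <= p1 + k%:R * p1 ^+ 2 by apply: addr_ge0 => //; apply: mulr_ge0 => //; exact: exprn_ge0.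
rewrite inE [w' \in nb w]inE [_ == (w \in W)]eq_sym.
case: ifP => [h|h]; last first.
  rewrite big1 // => v _; case: ifP => //; rewrite /cherry /= => /and3P[_ h1 h2].
  by rewrite h1 h2 in h.
apply: (@le_trans _ _ (\sum_v ((v == w')%:R * p1 + (e v w)%:R * p1 ^+ 2))).
  apply: ler_sum => v _; rewrite /cherry /F /= h andbT; case: (e v w); rewrite ?mul1r //.
  by rewrite mul0r addr0 mulr_ge0.
rewrite big_split /= lerD //.
  by rewrite (bigD1 w') //= eqxx mul1r big1 ?addr0 // => v /negbTE->; rewrite mul0r.
rewrite -mulr_suml ler_wpM2r ?exprn_ge0 // -natr_sum ler_nat -(card_nb e_reg w).
rewrite -sum1_card [leqRHS]big_mkcond /=; apply: leq_sum => v _.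
by rewrite inE e_sym; case: (e w v).
Qed.

Lemma cherry_weight : (mono W <= 2 * (level W).+1 * k)%N ->
  \sum_(t | cherry t) p1 ^+ #|cherry_edges t| <= 12 * (level W).+1%:R * L ^+ 2.
Proof.
rewrite -(ler_nat R) !natrM => mW; apply: (le_trans sum_cherry).
have q0 : 0 <= p1 + k%:R * p1 ^+ 2 by apply: addr_ge0 => //; apply: mulr_ge0 => //; exact: exprn_ge0.
apply: (le_trans (ler_wpM2r q0 mW)).
have -> : 2 * (level W).+1%:R * k%:R * (p1 + k%:R * p1 ^+ 2)
   = 2 * (level W).+1%:R * (k%:R * p1 + (k%:R * p1) ^+ 2) by ring.
rewrite (p1k L k_gt0).
have -> : 12 * (level W).+1%:R * L ^+ 2 = 2 * (level W).+1%:R * (6 * L ^+ 2) by ring.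
rewrite ler_wpM2l ?mulr_ge0 //.
have : L * 1 <= L * L by rewrite ler_wpM2l ?(ltW Lp) //; move: L_ge; lra.
by rewrite !expr2; lra.
Qed.

Lemma low_close chi v v' p p' : ~~ close_low chi -> low chi v -> low chi v' ->
  path (joined e (H1 chi)) v p -> path (joined e (H1 chi)) v' p' -> last v p = last v' p' ->
  (size p <= 2)%N -> (size p' <= 2)%N -> v' = v.
Proof.
move=> ncl lv lv' vp vp' elast sp sp'.
have [rp lp szp] := path_rev_belast (joined_sym e_sym (H1 chi)) vp'.
have := @low_walk R T e L (H0 chi) (H1 chi) v (p ++ rev (belast v' p')) (spread_low_close ncl).
rewrite cat_path vp last_cat elast rp lp size_cat szp; apply=> //.
exact: (@leq_add _ _ 2 2).
Qed.

(** Choose a cherry at each of [b] bad vertices. Two cherries with a common vertex would put two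
    low-degree vertices within distance 4, so they are disjoint and [Pr_low] treats all of them at
    once on at most [3 * b] vertices. The sum over tuples of cherries factorises into a power. *)
Lemma Pr_bad_cut b : (300 * b <= k)%N ->
  Pr (fun chi => ~~ close_low chi && (b <= #|[set v | bad e L (H0 chi) (H1 chi) W v]|)%N)
  <= ((\sum_(t | cherry t) p1 ^+ #|cherry_edges t|) * expR (- (3 / 4 * L))) ^+ b.
Proof.
move=> bk.
pose compat (g : {ffun 'I_b -> V}) := [forall i, forall j, (i != j) ==> [disjoint cherry_vertices (g i) & cherry_vertices (g j)]].
pose Z (g : {ffun 'I_b -> V}) := \bigcup_i cherry_edges (g i).
apply: (le_trans (@Pr_union R _ _ _ P0 P01 P1 {ffun 'I_b -> V}
  (fun g => (g \in ffun_on cherry) && compat g) _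
  (fun g chi => (Z g \subset H1 chi) && [forall i, low chi (g i).1.1]) _)).
  move=> chi /andP[ncl bB].
  pose B := [set v | bad e L (H0 chi) (H1 chi) W v].
  pose Q v := [pred x : T * T | [&& joined e (H1 chi) v x.1, joined e (H1 chi) x.1 x.2
     & (x.1 \in W) == (x.2 \in W)]].
  (* The triple [((v, v), v)] is a default that is never reached for [v] in [B]. *)
  pose f v : V := if [pick x | Q v x] is Some x then ((v, x.1), x.2) else ((v, v), v).
  have fP v : v \in B -> [/\ low chi v, (f v).1.1 = v & Q v ((f v).1.2, (f v).2)].
    rewrite inE /bad => /andP[lv /existsP[w /existsP[w' h]]]; split=> //.
      by rewrite /f; case: pickP.
    by rewrite /f; case: pickP => [x //|/(_ (w, w'))]; rewrite /= h.
  pose v_ (i : 'I_b) := enum_val (widen_ord bB i).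
  have vB i : v_ i \in B by exact: enum_valP.
  have v_inj : injective v_ by move=> i j /enum_val_inj/(congr1 val)/= ij; exact: val_inj.
  pose g : {ffun 'I_b -> V} := [ffun i => f (v_ i)].
  have gE i : g i = f (v_ i) by rewrite ffunE.
  have reach i x : x \in cherry_vertices (g i) ->
      exists p, [/\ path (joined e (H1 chi)) (v_ i) p, last (v_ i) p = x & (size p <= 2)%N].
    have [_ fv /and3P[/= h1 h2 _]] := fP _ (vB i).
    rewrite gE /cherry_vertices fv !inE => /orP[/orP[]|] /eqP->.
    - by exists [::].
    - by exists [:: (f (v_ i)).1.2]; rewrite /= h1.
    - by exists [:: (f (v_ i)).1.2; (f (v_ i)).2]; rewrite /= h1 h2.
  exists g.
    apply/andP; split.
      apply/ffun_onP => i; rewrite gE; have [_ fv /and3P[/= h1 h2 h3]] := fP _ (vB i).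
      by rewrite unfold_in /cherry fv h3; case/andP: h1 => -> _; case/andP: h2 => -> _.
    apply/forallP => i; apply/forallP => j; apply/implyP => ij.
    rewrite -setI_eq0; apply/eqP/setP => x; rewrite in_set0; apply/negP; rewrite in_setI.
    move=> /andP[/reach[p [vp lp sp]] /reach[p' [vp' lp' sp']]].
    have [li _ _] := fP _ (vB i); have [lj _ _] := fP _ (vB j).
    have := low_close ncl li lj vp vp' (etrans lp (esym lp')) sp sp'.
    by move/v_inj => eij; rewrite eij eqxx in ij.
  apply/andP; split.
    apply/bigcupsP => i _; rewrite gE; have [_ fv /and3P[/= h1 h2 h3]] := fP _ (vB i).
    apply/subsetP => S; rewrite !inE fv => /orP[]/eqP->.
      by case/andP: h1 => _; rewrite inE.
    by case/andP: h2 => _; rewrite inE.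
  by apply/forallP => i; rewrite gE; have [lv -> _] := fP _ (vB i).
have cases : b%:R * (3 / 4 * L) = 3 / 4 * b%:R * L by ring.
rewrite exprMn -expR_natM mulrN cases.
have -> : (\sum_(t | cherry t) p1 ^+ #|cherry_edges t|) ^+ b
    = \sum_(g in ffun_on cherry : {pred {ffun 'I_b -> V}}) \prod_i p1 ^+ #|cherry_edges (g i)|.
  by rewrite -(bigA_distr_big cherry (fun (_ : 'I_b) t => p1 ^+ #|cherry_edges t|)) prodr_const card_ord.
rewrite mulr_suml big_mkcondr; apply: ler_sum => g gv.
case: ifP => [/forallP cg|_]; last by rewrite mulr_ge0 ?expR_ge0 // prodr_ge0 // => i _; rewrite exprn_ge0.
have disj i j : i != j -> [disjoint cherry_vertices (g i) & cherry_vertices (g j)].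
  by move=> ij; have /forallP/(_ j)/implyP := cg i; apply.
have vZ t S : S \in cherry_edges t -> S \subset cherry_vertices t.
  by rewrite !inE => /orP[]/eqP->; apply/subsetP => x; rewrite !inE => /orP[]->; rewrite ?orbT.
have cZ : #|Z g| = (\sum_i #|cherry_edges (g i)|)%N.
  rewrite -sum1_card partition_disjoint_bigcup => [|i j ij].
    by apply: eq_bigr => i _; rewrite sum1_card.
  rewrite -setI_eq0; apply/eqP/setP => S; rewrite in_set0; apply/negP; rewrite in_setI.
  move=> /andP[Si Sj]; have [x xS] : exists x, x \in S.
    by move: Si; rewrite !inE => /orP[]/eqP->; [exists (g i).1.1 | exists (g i).1.2]; rewrite set21.
  have := disjointFr (disj i j ij) (subsetP (vZ _ _ Si) x xS).
  by rewrite (subsetP (vZ _ _ Sj) x xS).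
pose B := [set (g i).1.1 | i : 'I_b].
have cB : #|B| = b.
  rewrite card_imset ?card_ord // => i j eij; apply/eqP; apply: contraT => ij.
  have gi : (g i).1.1 \in cherry_vertices (g i) by rewrite !inE eqxx.
  by have := disjointFr (disj i j ij) gi; rewrite eij !inE eqxx.
apply: (le_trans (@Pr_low R T e k L k_gt0 e_reg L_ge L_k B (\bigcup_i cherry_vertices (g i)) (Z g) _ _ _ _ _)).
- by apply/subsetP => x /imsetP[i _ ->]; apply/bigcupP; exists i => //; rewrite !inE eqxx.
- move=> S /bigcupP[i _ Si]; apply: (subset_trans (vZ _ _ Si)); exact: (bigcup_sup i).
- apply: leq_trans bk; rewrite -[300%N]/(100 * 3)%N -mulnA leq_mul2l /=.
  apply: (leq_trans (card_bigcup_le _ _)); rewrite mulnC -[X in (_ <= X * _)%N]card_ord -sum_nat_const.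
  apply: leq_sum => i _; apply: (leq_trans (leq_cardU (subxx _))).
  by rewrite cards2 cards1; case: (_ != _).
- move=> chi /andP[ZH /forallP lo]; split=> // v /imsetP[i _ ->]; exact: lo.
by rewrite cB cZ -expr_sum.
Qed.
End Bad.
End Events.

(** * Bad vertices of all light cuts *)

Lemma bad_arith (R : realFieldType) (L A l b c : R) : 0 < L -> 10 * (c * A) <= L ->
  0 <= A -> 1 <= b -> l <= c * b ->
  - (b * (L / 5)) <= - (L / 10) - A * l.
Proof.
move=> Lp AL A0 b1 lb.
have h1 : A * l <= A * (c * b) by rewrite ler_wpM2l.
have h2 : 10 * (c * A) * b <= L * b by rewrite ler_wpM2r //; lra.
have h3 : L <= L * b by rewrite ler_peMr // ltW.
lra.
Qed.

Section Events.
Variables (R : realType) (T : finType) (e : rel T) (k n E J : nat) (L : R).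
Hypotheses (k_gt0 : (0 < k)%N) (e_sym : symmetric e) (e_irr : irreflexive e).
Hypothesis e_reg : forall x, #|[set y | e x y]| = k.
Hypotheses (L_ge : 400 <= L) (L_k : 40 * L <= k%:R).
Hypothesis E_ge3 : (3 <= E)%N.
Hypothesis J1 : (100 * (10 * J * k + 400 * J * #|T|) <= k * k)%N.
Hypothesis J2 : (20 * E * J <= k)%N.
Hypothesis J3 : (32 * n)%:R < J%:R * L.
Hypothesis L_entropy : 10 * (10000 * (entropy E)%:R) <= L.
Hypothesis L_poly : 12 * L ^+ 2 <= expR (L / 20).
Hypothesis k_ge : 300 * expR (L / 2) <= k%:R.

Local Notation mono := (mono e).
Local Notation level := (level e k).
Local Notation light := (light e k n E L).
Local Notation p0 := (@p0 R k L).
Local Notation p1 := (@p1 R k L).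
Local Notation Pr := (@prob R {set T} p0 p1).
Local Notation Omega := {ffun {set T} -> 'I_3}.
Local Notation q := (sample_size T k).

Let kp : 0 < k%:R :> R. Proof. by rewrite ltr0n. Qed.
Let Lp : 0 < L. Proof. by apply: lt_le_trans L_ge; rewrite ltr0n. Qed.
Let P0 := p0_ge0 k_gt0 L_ge.
Let P01 := p01 k_gt0 L_ge.
Let P1 := p1_le1 k_gt0 L_k.
Let P1_ge0 := p1_ge0 k_gt0 L_ge.

(** The level is capped near [n ^ (1 / 2)] so that the cherries fit into [k / 100] vertices. Above
    the cap, a bound on the number of all low-degree vertices takes over. *)
Definition many_bad (chi : Omega) : bool :=
  [exists W : {set T}, [&& light W, (level W).+1%:R <= expR (L / 2) &
     (level W)%:R < #|[set v | bad e L (H0 chi) (H1 chi) W v]|%:R * 10000 :> R]].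

(** Each bad vertex costs [expR (- (L / 5))], and there are more than [level W / 10000] of them;
    this beats the number of cuts once [L] is at least [10 * 10000] times the entropy. *)
Lemma Pr_many_bad :
  Pr (fun chi => ~~ close_low e L chi && many_bad chi) <= expR (- (L / 10)) * expR q%:R.
Proof.
pose P W := light W && ((level W).+1%:R <= expR (L / 2)).
apply: (le_trans (@Pr_union R _ _ _ P0 P01 P1 {set T} P _ (fun W chi => ~~ close_low e L chi &&
   ((level W %/ 10000).+1 <= #|[set v | bad e L (H0 chi) (H1 chi) W v]|)%N) _)).
  move=> chi /andP[ncl /existsP[W /and3P[h1 h2 h3]]]; exists W; first by rewrite /P h1 h2.
  by rewrite ncl ltn_divLR //; move: h3; rewrite -natrM ltr_nat.
rewrite /P big_mkcondr /=.
apply: (sum_light k_gt0 e_sym e_reg L_ge E_ge3 J1 J2 J3); first exact: expR_ge0.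
move=> W lW; case: ifP => [lev|_]; last by rewrite mulr_ge0 ?expR_ge0.
have mW : (mono W <= 2 * (level W).+1 * k)%N.
  have := ltn_ceil (mono W) (_ : (0 < 2 * k)%N); rewrite -/(level W) muln_gt0 k_gt0 => /(_ isT).
  by move=> /ltnW; rewrite mulnCA mulnA.
set b := (level W %/ 10000).+1.
have bl : (b <= (level W).+1)%N by rewrite ltnS leq_div.
have bk : (300 * b <= k)%N.
  rewrite -(ler_nat R) natrM; apply: le_trans k_ge; rewrite ler_wpM2l //.
  by apply: le_trans lev; rewrite ler_nat.
apply: (le_trans (Pr_bad_cut k_gt0 e_sym e_reg L_ge L_k W bk)).
have := cherry_weight k_gt0 e_sym e_irr e_reg L_ge mW; set s := (X in X <= _) => hs.
have s0 : 0 <= s by apply: sumr_ge0 => t _; exact: exprn_ge0.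
have sE : s * expR (- (3 / 4 * L)) <= expR (- (L / 5)).
  have -> : - (L / 5) = L / 2 + L / 20 + - (3 / 4 * L) by field.
  rewrite expRD ler_wpM2r ?expR_ge0 //; apply: (le_trans hs); rewrite expRD.
  have -> : 12 * (level W).+1%:R * L ^+ 2 = (level W).+1%:R * (12 * L ^+ 2) by ring.
  by rewrite ler_pM // mulr_ge0 // exprn_ge0 // ltW.
apply: (@le_trans _ _ (expR (- (L / 5)) ^+ b)).
  by rewrite lerXn2r ?nnegrE ?expR_ge0 ?mulr_ge0 ?expR_ge0.
rewrite -expR_natM -expRD ler_expR mulrN; apply: bad_arith L_entropy _ _ _ => //.
- by rewrite ler1n.
- rewrite -natrM ler_nat mulnC; exact: ltn_ceil.
Qed.

End Events.

(** * From independent sets to hitting times *)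

Section Matching.
Local Open Scope nat_scope.
Variables (T : finType) (e : rel T) (k : nat).
Hypotheses (k_gt0 : 0 < k) (e_sym : symmetric e) (e_irr : irreflexive e).
Hypothesis e_reg : forall x, #|[set y | e x y]| = k.

Lemma edgesP S : reflect (exists v w, e v w /\ S = [set v; w]) (S \in edges e).
Proof.
rewrite inE; apply: (iffP existsP) => [[v /existsP[w /andP[vw /eqP->]]]|[v [w [vw ->]]]].
  by exists v, w.
by exists v; apply/existsP; exists w; rewrite vw /=.
Qed.

Lemma edge_mem v w : e v w -> [set v; w] \in edges e.
Proof. by move=> vw; apply/edgesP; exists v, w. Qed.

Lemma no_isolatedP (F : seq {set T}) : {subset F <= edges e} ->
  reflect (forall v, exists2 w, e v w & [set v; w] \in F) (no_isolated F).
Proof.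
move=> FE; apply: (iffP forallP) => h v.
  have /hasP[S SF vS] := h v; have /edgesP[a [b [ab eS]]] := FE _ SF.
  move: vS; rewrite eS !inE => /orP[]/eqP ev.
    by exists b; rewrite ev // -eS.
  by exists a; rewrite ev; [rewrite e_sym | rewrite setUC -eS].
by have [w _ vwF] := h v; apply/hasP; exists [set v; w]; rewrite ?set21.
Qed.

Lemma matching_no_isolated (F : seq {set T}) : has_perfect_matching F -> no_isolated F.
Proof.
case/existsP => M /andP[/forall_inP MF /forallP Mc]; apply/forallP => v.
have /card_gt0P[S] : 0 < #|[set S in M | v \in S]| by rewrite (eqP (Mc v)).
by rewrite inE => /andP[SM vS]; apply/hasP; exists S => //; exact: MF.
Qed.

Variables (c : T -> bool) (n : nat).
Hypotheses (e_bip : forall x y, e x y -> c x != c y) (cardT : #|T| = 2 * n).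

(** A colour class has no monochromatic edge, so [mono_in_out] reduces to
    [k * (2 * n) = 2 * k * #|W|]. *)
Lemma card_colour b : #|[set v | c v == b]| = n.
Proof.
have mono0 v : mono_deg e [set v | c v == b] v = 0.
  apply/eqP; rewrite cards_eq0; apply/eqP/setP => w; rewrite !inE.
  by apply/negP => /andP[/e_bip]; case: (c v); case: (c w); case: b.
have := mono_in_out k_gt0 e_sym e_reg cardT [set v | c v == b].
rewrite /mono_in /mono !big1 // !add0n [k * _]mulnCA -mulnA => /eqP.
by rewrite eqn_mul2l /= eqn_mul2l -[k == 0]negbK -lt0n k_gt0 /= => /eqP.
Qed.

(** For [S] inside [A], the set [S :|: (B :\: nbr_set f S)] is independent; it exceeds [n] exactly
    when [S] violates Hall's condition. *)
Lemma matching_of_independent (F : seq {set T}) :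
  (forall W : {set T}, (forall v w, v \in W -> w \in W -> ~~ (e v w && ([set v; w] \in F))) ->
     #|W| <= n) -> has_perfect_matching F.
Proof.
move=> ind; pose f v w := e v w && ([set v; w] \in F).
pose A := [set v | c v == true]; pose B := [set v | c v == false].
have fAB v w : f v w -> v \in A -> w \in B.
  by rewrite !inE => /andP[/e_bip vw _] /eqP cv; move: vw; rewrite cv; case: (c w).
have AB v : (v \in B) = (v \notin A) by rewrite !inE; case: (c v).
have [S SA|g g_inj gf] := @hall T A f.
  have NB : nbr_set f S \subset B.
    by apply/subsetP => y /nbr_setP[x xS xy]; apply: (fAB x) => //; exact: (subsetP SA).
  have := ind (S :|: (B :\: nbr_set f S)); rewrite cardsU.
  have -> : S :&: (B :\: nbr_set f S) = set0.
    apply/setP => v; rewrite !in_setI in_setD in_set0 AB; apply/negP => /and3P[vS _ /negP[]].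
    exact: (subsetP SA).
  rewrite cards0 subn0 => h.
  have : #|S| + #|B :\: nbr_set f S| <= n.
    apply: h => v w vW wW; apply/negP => fvw; move: vW wW; rewrite !in_setU !in_setD.
    have fwv : f w v by rewrite /f e_sym setUC.
    move=> /orP[vS|/andP[vN vB]] /orP[wS|/andP[wN wB]].
    - by have := fAB _ _ fvw (subsetP SA _ vS); rewrite AB (subsetP SA _ wS).
    - by case/negP: wN; apply/nbr_setP; exists v.
    - by case/negP: vN; apply/nbr_setP; exists w.
    - by have := e_bip (proj1 (andP fvw)); move: vB wB; rewrite !inE => /eqP-> /eqP->.
  have := cardsID (nbr_set f S) B; rewrite (setIidPr NB) (card_colour false); lia.
have gB : g @: A = B.
  apply/eqP; rewrite eqEcard (card_in_imset g_inj) !card_colour leqnn andbT.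
  by apply/subsetP => y /imsetP[x xA ->]; exact: (fAB x _ (gf x xA)).
pose M := [set [set x; g x] | x in A].
apply/existsP; exists M; apply/andP; split.
  by apply/forall_inP => S /imsetP[x xA ->]; have /andP[] := gf x xA.
apply/forallP => v; apply/eqP.
have [x [xA vx]] : exists x, x \in A /\ v \in [set x; g x].
  case: (boolP (v \in A)) => vA; first by exists v; rewrite set21.
  have : v \in g @: A by rewrite gB AB.
  by case/imsetP => x xA ->; exists x; rewrite set22.
rewrite -(cards1 [set x; g x]); apply: eq_card => S; rewrite !inE.
apply/andP/eqP => [[/imsetP[y yA ->]]|->]; last by split=> //; exact: imset_f.
have gxB z : z \in A -> g z \in B by move=> zA; apply: (fAB z) => //; exact: gf.
move: vx; rewrite !inE => /orP[]/eqP-> /orP[]/eqP exy.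
- by rewrite exy.
- by have := gxB y yA; rewrite -exy AB xA.
- by have := gxB x xA; rewrite exy AB yA.
- by rewrite (g_inj _ _ xA yA exy).
Qed.

End Matching.

Section Process.
Local Open Scope nat_scope.
Variables (T : finType) (e : rel T) (k n : nat) (c : T -> bool).
Hypotheses (k_gt0 : 0 < k) (e_sym : symmetric e) (e_irr : irreflexive e).
Hypothesis e_reg : forall x, #|[set y | e x y]| = k.
Hypotheses (e_bip : forall x y, e x y -> c x != c y) (cardT : #|T| = 2 * n).
Variable chi : {ffun {set T} -> 'I_3}.
Hypothesis isolated0 : exists v, forall w, ~~ joined e (H0 chi) v w.
Hypothesis isolated1 : forall v, exists w, joined e (H1 chi) v w.
Hypothesis independent_small : forall f : rel T,
  (forall v w, f v w -> joined e (H1 chi) v w) -> (forall v w, joined e (H0 chi) v w -> f v w) ->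
  (forall v, exists w, f v w) ->
  forall W : {set T}, (forall v w, v \in W -> w \in W -> ~~ f v w) -> #|W| <= n.

Lemma hitting_times_eq s : perm_eq s (enum (edges e)) ->
  sorted leq [seq nat_of_ord (chi x) | x <- s] ->
  hitting_time (@has_perfect_matching T) s = hitting_time (@no_isolated T) s.
Proof.
move=> sE srt.
have memE S : (S \in s) = (S \in edges e) by rewrite (perm_mem sE) mem_enum.
have subE t : {subset take t s <= edges e} by move=> S /mem_take; rewrite memE.
have subE' : {subset s <= edges e} by move=> S; rewrite memE.
have full : no_isolated s.
  apply/(no_isolatedP e_sym subE') => v; have [w /andP[vw _]] := isolated1 v.
  by exists w; rewrite // memE edge_mem.
have ts : hitting_time (@no_isolated T) s <= size s by apply: hitting_time_le; rewrite ?take_size.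
have := hitting_time_sat ts; move: ts; set t := hitting_time _ _ => ts noF.
(* The vertex isolated in [H0] has received an edge of positive colour by time [t], and all edges of
   colour 0 come before that edge. *)
have F0 S : S \in edges e -> S \in H0 chi -> S \in take t s.
  move=> SE; rewrite inE => /eqP S0; apply: contraT => St.
  have Sd : S \in drop t s by move: SE; rewrite -memE -{1}(cat_take_drop t s) mem_cat (negbTE St).
  have [v iso] := isolated0; have [w vw vwF] := (no_isolatedP e_sym (subE t) noF) v.
  have := iso w; rewrite /joined vw inE -leqn0 /=.
  by have := sorted_take_drop srt vwF Sd; rewrite S0 => ->.
(* Before an edge of colour 2 arrives, all edges of [H1] are present and no vertex is isolated, so
   the hitting time would be at most the index of that edge. *)
have F1 S : S \in take t s -> S \in H1 chi.
  move=> St; rewrite inE; apply: contraT; rewrite -ltnNge => S1.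
  have Ss := mem_take St.
  have it : index S s < t by have := index_ltn St.
  have /negP := hitting_time_before it (index_size S s); case.
  apply/(no_isolatedP e_sym (subE _)) => v; have [w /andP[vw]] := isolated1 v.
  rewrite inE => vw1; exists w => //; have := edge_mem vw; rewrite -memE.
  rewrite -{1}(cat_take_drop (index S s) s) mem_cat => /orP[//|vwd]; exfalso.
  move: vwd; rewrite (drop_nth S) ?index_mem // nth_index // inE => /orP[/eqP vwS|vwd].
    by move: vw1; rewrite vwS leqNgt S1.
  have Stk : S \in take (index S s).+1 s.
    by rewrite (take_nth S) ?index_mem // nth_index // mem_rcons inE eqxx.
  by have := leq_trans S1 (leq_trans (sorted_take_drop srt Stk vwd) vw1).
apply/eqP; rewrite eqn_leq; apply/andP; split; last first.
  rewrite leqNgt; apply/negP => lt.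
  have := hitting_time_before lt (leq_trans (ltnW lt) ts).
  by rewrite matching_no_isolated // hitting_time_sat // (leq_trans (ltnW lt)).
apply: hitting_time_le => //.
apply: (matching_of_independent k_gt0 e_sym e_reg e_bip cardT).
apply: independent_small.
- by move=> v w /andP[vw /F1 h]; rewrite /joined vw.
- by move=> v w /andP[vw h]; rewrite vw F0 ?edge_mem.
- by move=> v; have [w vw vwF] := (no_isolatedP e_sym (subE t) noF) v; exists w; rewrite vw.
Qed.
End Process.

(** * The total failure probability *)

Section Failure.
Variables (R : realType) (T : finType) (e : rel T) (k n E J : nat) (L : R) (c : T -> bool).
Hypotheses (k_gt0 : (0 < k)%N) (e_sym : symmetric e) (e_irr : irreflexive e).
Hypothesis e_reg : forall x, #|[set y | e x y]| = k.
Hypotheses (e_bip : forall x y, e x y -> c x != c y) (cardT : #|T| = (2 * n)%N).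
Hypotheses (expL : expR L = n%:R) (L_ge : 400 <= L) (L_k : 40 * L <= k%:R).
Hypotheses (E_ge3 : (3 <= E)%N) (E_ge : 3 * expR 1200 <= E%:R :> R).
Hypothesis J1 : (100 * (10 * J * k + 400 * J * #|T|) <= k * k)%N.
Hypothesis J2 : (20 * E * J <= k)%N.
Hypothesis J3 : (32 * n)%:R < J%:R * L.
Hypothesis L_entropy : 10 * (10000 * (entropy E)%:R) <= L.
Hypothesis L_poly : 12 * L ^+ 2 <= expR (L / 20).
Hypothesis k_ge : 300 * expR (L / 2) <= k%:R.
Hypothesis L_big : 240 * (E * n)%:R <= k%:R * L.
Hypothesis q_small : (sample_size T k)%:R <= L / 100.

Local Notation p0 := (@p0 R k L).
Local Notation p1 := (@p1 R k L).
Local Notation Pr := (@prob R {set T} p0 p1).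
Local Notation Omega := {ffun {set T} -> 'I_3}.

Let kp : 0 < k%:R :> R. Proof. by rewrite ltr0n. Qed.
Let Lp : 0 < L. Proof. by apply: lt_le_trans L_ge; rewrite ltr0n. Qed.
Let P0 := p0_ge0 k_gt0 L_ge.
Let P01 := p01 k_gt0 L_ge.
Let P1 := p1_le1 k_gt0 L_k.

Let ev0 (chi : Omega) := [forall v, exists w, joined e (H0 chi) v w].
Let ev1 (chi : Omega) := [exists v, [forall w, ~~ joined e (H1 chi) v w]].
Let ev2 (chi : Omega) := [exists W : {set T}, (inner e W :&: H0 chi == set0) &&
        (8 * (n * k)%:R < (mono_in e W)%:R * L)].
Let ev3 (chi : Omega) := close_low e L chi.
Let ev4 (chi : Omega) := [exists W : {set T}, [&& light e k n E L W, (k <= mono_in e W)%N,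
    (mono e W <= 3 * mono_in e W)%N &
    8 * k%:R * #|inner e W :&: H0 chi|%:R < (mono_in e W)%:R * L]].
Let ev5 (chi : Omega) := [exists W : {set T}, exists Fa : {set T}, exists Fb : {set T},
    [&& light e k n E L W, [forall v in Fa, (E * mono_deg e W v <= 2 * k)%N], (E * #|Fb| <= k)%N &
     50 * (#|Fa| + #|Fb|)%:R * L + (level e k W)%:R * L
       < #|touch e W Fa Fb :&: H0 chi|%:R * 10000]].
(** The threshold is matched to the cap in [many_bad]: for a cut above the cap, this many vertices
    are still at most [level / 10000]. *)
Let ev6 (chi : Omega) := (expR (L / 2) - 1) / 10000 < #|[set v | low_degree e L (H0 chi) v]|%:R.
Let ev7 (chi : Omega) := ~~ close_low e L chi && many_bad e k n E L chi.
Let bad_event (chi : Omega) :=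
  ev0 chi || (ev1 chi || (ev2 chi || (ev3 chi || (ev4 chi || (ev5 chi || (ev6 chi || ev7 chi)))))).

Lemma expR_half_big : 2 <= expR (L / 2).
Proof. by apply: le_trans (expR_ge1Dx _); move: L_ge; lra. Qed.

Lemma Pr_bad_event : Pr bad_event <= 41 * 1000 * expR (- (L / 100)).
Proof.
set x := expR (- (L / 100)).
have x0 : 0 <= x := expR_ge0 _.
have le_x y : y <= - (L / 100) -> expR y <= x by rewrite ler_expR.
have U := @Pr_predU R {set T} p0 p1 P0 P01 P1.
have b0 : Pr ev0 <= 2 * x.
  apply: (le_trans (Pr_no_isolated0 k_gt0 e_irr e_reg cardT expL L_ge L_k)).
  have h1 : expR (- (L / 20)) <= x by apply: le_x; move: Lp; lra.
  have h2 : 2 * p0 <= x.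
    rewrite -(ler_pM2l kp) mulrCA (p0k L k_gt0).
    have h3 : 300 * expR (L / 2) * x <= k%:R * x by rewrite ler_wpM2r.
    have h4 : 1 + (L / 2 - L / 100) <= expR (L / 2) * x by rewrite /x -expRD; exact: expR_ge1Dx.
    by move: h3 h4 L_ge; lra.
  by move: h1 h2; lra.
have b1 : Pr ev1 <= 2 * x.
  apply: (le_trans (Pr_isolated1 k_gt0 e_irr e_reg cardT expL L_ge L_k)).
  by rewrite ler_wpM2l //; apply: le_x; move: Lp; lra.
have b2 : Pr ev2 <= x.
  apply: (le_trans (Pr_large_empty_inner e k_gt0 cardT L_ge L_k)); apply: le_x.
  by rewrite lerN2 -expL; apply: le_trans (expR_ge1Dx _); move: Lp; lra.
have b3 : Pr ev3 <= x.
  apply: (le_trans (Pr_close_low k_gt0 e_reg cardT expL L_ge L_k)).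
  have h : (12 * L ^+ 2) ^+ 2 <= expR (L / 20) ^+ 2.
    by rewrite lerXn2r ?nnegrE ?expR_ge0 ?mulr_ge0 ?exprn_ge0 ?(ltW Lp).
  have h2 : 128 * L ^+ 4 <= expR (L / 20) ^+ 2.
    apply: le_trans h; have : 0 <= L ^+ 4 by rewrite exprn_ge0 ?(ltW Lp).
    by rewrite exprMn -exprM; set y := L ^+ 4; lra.
  apply: (le_trans (ler_wpM2r (expR_ge0 _) h2)); rewrite -expR_natM -expRD; apply: le_x.
  by move: Lp; lra.
have ent : 50 * (entropy E)%:R <= L.
  by have := ler0n R (entropy E); move: L_entropy; lra.
have b4 : Pr ev4 <= x.
  apply: (le_trans (Pr_few_inner k_gt0 e_sym e_reg L_ge L_k E_ge3 J1 J2 J3 ent)).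
  by rewrite -expRD; apply: le_x; move: q_small; lra.
have b5 : Pr ev5 <= x.
  apply: (le_trans (Pr_dense_touch k_gt0 e_sym e_reg cardT expL L_ge L_k E_ge3 E_ge J1 J2 J3 ent)).
  by rewrite -expRD; apply: le_x; move: q_small L_ge; lra.
have b6 : Pr ev6 <= 40 * 1000 * x.
  have X0 : 0 < (expR (L / 2) - 1) / 10000.
    by rewrite divr_gt0 ?ltr0n // subr_gt0 expR_gt1 divr_gt0.
  apply: (le_trans (Pr_many_low k_gt0 e_reg cardT expL L_ge L_k X0)).
  have h1 : expR (L / 4) <= expR (L / 2) * x by rewrite /x -expRD ler_expR; move: Lp; lra.
  rewrite mulrAC ler_pdivrMr //.
  have h2 : expR (L / 2) * x <= 2 * (expR (L / 2) - 1) * x.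
    by rewrite ler_wpM2r //; have := expR_half_big; lra.
  have -> : 40 * 1000 * x * ((expR (L / 2) - 1) / 10000) = 2 * (2 * (expR (L / 2) - 1) * x) by field.
  by move: h1 h2; lra.
have b7 : Pr ev7 <= x.
  apply: (le_trans (Pr_many_bad k_gt0 e_sym e_irr e_reg L_ge L_k E_ge3 J1 J2 J3 L_entropy L_poly k_ge)).
  by rewrite -expRD; apply: le_x; move: q_small Lp; lra.
have h0 := U ev0 (fun chi => ev1 chi || (ev2 chi || (ev3 chi || (ev4 chi || (ev5 chi || (ev6 chi || ev7 chi)))))).
have h1 := U ev1 (fun chi => ev2 chi || (ev3 chi || (ev4 chi || (ev5 chi || (ev6 chi || ev7 chi))))).
have h2 := U ev2 (fun chi => ev3 chi || (ev4 chi || (ev5 chi || (ev6 chi || ev7 chi)))).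
have h3 := U ev3 (fun chi => ev4 chi || (ev5 chi || (ev6 chi || ev7 chi))).
have h4 := U ev4 (fun chi => ev5 chi || (ev6 chi || ev7 chi)).
have h5 := U ev5 (fun chi => ev6 chi || ev7 chi).
have h6 := U ev6 ev7.
apply: (le_trans h0); apply: (le_trans (lerD b0 h1)); apply: (le_trans (lerD (lexx _) (lerD b1 h2))).
apply: (le_trans (lerD (lexx _) (lerD (lexx _) (lerD b2 h3)))).
apply: (le_trans (lerD (lexx _) (lerD (lexx _) (lerD (lexx _) (lerD b3 h4))))).
apply: (le_trans (lerD (lexx _) (lerD (lexx _) (lerD (lexx _) (lerD (lexx _) (lerD b4 h5)))))).
apply: (le_trans (lerD (lexx _) (lerD (lexx _) (lerD (lexx _) (lerD (lexx _) (lerD (lexx _) (lerD b5 h6))))))).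
by move: b6 b7 x0; lra.
Qed.

Lemma good_hitting_times s (chi : Omega) : perm_eq s (enum (edges e)) ->
  sorted leq [seq nat_of_ord (chi x) | x <- s] -> ~~ bad_event chi ->
  hitting_time (@has_perfect_matching T) s = hitting_time (@no_isolated T) s.
Proof.
move=> sE srt; rewrite /bad_event !negb_or => /and5P[n0 n1 n2 n3 /and4P[n4 n5 n6 n7]].
apply: (hitting_times_eq k_gt0 e_sym e_reg e_bip cardT _ _ _ sE srt).
- move: n0; rewrite /ev0 negb_forall => /existsP[v]; rewrite negb_exists => /forallP h.
  by exists v.
- move=> v; move: n1; rewrite /ev1 negb_exists => /forallP/(_ v); rewrite negb_forall.
  by move=> /existsP[w]; rewrite negbK; exists w.
apply: (no_large_independent k_gt0 e_sym e_reg cardT (H01 chi) E_ge3 L_ge L_big).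
- exact: (spread_low_close n3).
- move=> W W0; move: n2; rewrite /ev2 negb_exists => /forallP/(_ W).
  by rewrite W0 eqxx /= -leNgt.
- move=> W Fa Fb lW ha hb; move: n5; rewrite /ev5 negb_exists => /forallP/(_ W).
  rewrite negb_exists => /forallP/(_ Fa); rewrite negb_exists => /forallP/(_ Fb).
  by rewrite lW hb (introT forall_inP ha) /= -leNgt.
- move=> W lW kx mx; move: n4; rewrite /ev4 negb_exists => /forallP/(_ W).
  by rewrite lW kx mx /= -leNgt.
- move=> W lW; case: (lerP (level e k W).+1%:R (expR (L / 2))) => lev.
    move: n7; rewrite /ev7 n3 /many_bad negb_exists => /forallP/(_ W).
    by rewrite lW lev /= -leNgt.
  have sub : (#|[set v | bad e L (H0 chi) (H1 chi) W v]| <= #|[set v | low_degree e L (H0 chi) v]|)%N.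
    by apply/subset_leq_card/subsetP => v; rewrite !inE => /andP[].
  move: n6 lev sub; rewrite /ev6 -leNgt -(ler_nat R) -[(level e k W).+1%:R]natr1 ler_pdivlMr ?ltr0n //.
  move=> h1 h2 h3; apply: (le_trans (ler_wpM2r (ler0n _ _) h3)).
  by apply: (le_trans h1); rewrite lerBlDr; exact: ltW.
Qed.

Lemma failure_count :
  (count (fun s => hitting_time (@has_perfect_matching T) s != hitting_time (@no_isolated T) s)
     (processes e))%:R <= 41 * 1000 * expR (- (L / 100)) * (#|edges e|`!)%:R :> R.
Proof.
apply: (@le_trans _ _ (Pr bad_event * (#|edges e|`!)%:R)); last first.
  by rewrite ler_wpM2r // Pr_bad_event.
apply: (count_le_Pr P0 P01 P1) => s chi sE srt; apply: contraR => nb.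
by rewrite (good_hitting_times sE srt nb).
Qed.

End Failure.

(** * Asymptotics *)

Section Sizes.
Variables (R : realType) (k n E : nat) (L : R).
Hypotheses (E_ge3 : (3 <= E)%N) (L_ge : 400 <= L) (expL : expR L = n%:R) (kn : (k <= 2 * n)%N).
(* With [L = log n] this only asks for [k >= C n / sqrt (log n)]. *)
Hypothesis dense : (2000 * E%:R * n%:R) ^+ 2 <= k%:R ^+ 2 * L.

Let Lp : 0 < L. Proof. by apply: lt_le_trans L_ge; rewrite ltr0n. Qed.
Let E3 : 3 <= E%:R :> R. Proof. by rewrite ler_nat. Qed.
Let n_ge0 : 0 <= n%:R :> R. Proof. exact: ler0n. Qed.
Let k_ge0 : 0 <= k%:R :> R. Proof. exact: ler0n. Qed.

Lemma dense_linear : 2000 * E%:R * n%:R <= k%:R * L.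
Proof.
rewrite -(@ler_pXn2r _ 2) ?nnegrE ?mulr_ge0 ?(ltW Lp) //; apply: (le_trans dense).
rewrite exprMn ler_wpM2l ?exprn_ge0 // expr2 ler_peMr ?(ltW Lp) //; move: L_ge; lra.
Qed.

Lemma dense_sparsity : 240 * (E * n)%:R <= k%:R * L.
Proof.
apply: le_trans dense_linear; rewrite natrM.
have : 0 <= E%:R * n%:R :> R by rewrite mulr_ge0.
lra.
Qed.

Lemma dense_degree : 300 * expR (L / 2) <= k%:R.
Proof.
rewrite -(ler_pM2r Lp); apply: le_trans dense_linear; rewrite -expL.
have h : L <= 2 * expR (L / 2) by have := expR_ge1Dx (L / 2); lra.
have -> : expR L = expR (L / 2) * expR (L / 2) by rewrite -expRD; congr expR; field.
have h2 : expR (L / 2) * L <= expR (L / 2) * (2 * expR (L / 2)) by rewrite ler_wpM2l ?expR_ge0.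
have h3 : 3 * (expR (L / 2) * expR (L / 2)) <= E%:R * (expR (L / 2) * expR (L / 2)).
  by rewrite ler_wpM2r // mulr_ge0 ?expR_ge0.
have h4 : 0 <= expR (L / 2) * expR (L / 2) by rewrite mulr_ge0 ?expR_ge0.
by move: h2 h3 h4; lra.
Qed.

Lemma dense_degree_linear : 40 * L <= k%:R.
Proof. by apply: le_trans dense_degree; have := expR_ge1Dx (L / 2); move: L_ge; lra. Qed.

Lemma dense_k_gt0 : (0 < k)%N.
Proof. by rewrite -(ltr_nat R); apply: lt_le_trans dense_degree_linear; rewrite mulr_gt0. Qed.

Lemma dense_sample (T : finType) : #|T| = (2 * n)%N -> (sample_size T k)%:R <= L / 100.
Proof.
move=> cardT; have kp : 0 < k%:R :> R by rewrite ltr0n dense_k_gt0.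
have : (sample_size T k * k <= 4 * n)%N.
  by rewrite /sample_size cardT mulnA; exact: leq_trunc_div.
rewrite -(ler_nat R) !natrM => h; rewrite -(ler_pM2r kp).
have h2 : 3 * n%:R <= E%:R * n%:R :> R by rewrite ler_wpM2r.
by have := dense_linear; move: h h2 n_ge0; lra.
Qed.

(** A light cut has level at most [32 * n / L]. *)
Definition max_level : nat := (Num.truncn ((32 * n)%:R / L)).+1.

Lemma max_level_gt : (32 * n)%:R < max_level%:R * L.
Proof. by rewrite -ltr_pdivrMr // /max_level; exact: truncnS_gt. Qed.

Lemma max_level_le : max_level%:R * L <= 33 * n%:R.
Proof.
have d0 : 0 <= (32 * n)%:R / L by rewrite divr_ge0 ?(ltW Lp).
have h : (Num.truncn ((32 * n)%:R / L))%:R <= (32 * n)%:R / L by rewrite truncn_le.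
have h2 : (Num.truncn ((32 * n)%:R / L))%:R * L <= (32 * n)%:R by rewrite -ler_pdivlMr.
have h3 : L <= n%:R by rewrite -expL; apply: le_trans (expR_ge1Dx _); lra.
by rewrite /max_level -natr1 mulrDl mul1r; move: h2 h3; rewrite natrM; lra.
Qed.

Lemma max_level_flips : (20 * E * max_level <= k)%N.
Proof.
rewrite -(ler_nat R) !natrM -(ler_pM2r Lp); apply: le_trans dense_linear.
have := ler_wpM2l (ler0n R E) max_level_le.
have : 0 <= E%:R * n%:R :> R by rewrite mulr_ge0.
by set j := max_level%:R; set x := E%:R; lra.
Qed.

(** The quadratic density enters here. About [n / L] samples of [O(n / k)] vertices each are set
    aside in the decoding, and together with the misjudged vertices they must number at most
    [k / 100]. *)
Lemma max_level_errors : (100 * (10 * max_level * k + 400 * max_level * (2 * n)) <= k * k)%N.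
Proof.
apply: (@leq_trans (100 * (820 * (max_level * n)))).
  rewrite leq_mul2l /=; have : (max_level * k <= max_level * (2 * n))%N by rewrite leq_mul2l kn orbT.
  by rewrite mulnCA; set a := (max_level * n)%N; rewrite -mulnA [(400 * _ * _)%N]mulnAC; lia.
rewrite -(ler_nat R) !natrM -(ler_pM2r Lp).
have h1 := ler_wpM2r n_ge0 max_level_le.
have h2 : (6000 * n%:R) ^+ 2 <= k%:R ^+ 2 * L.
  apply: le_trans dense; rewrite lerXn2r ?nnegrE ?mulr_ge0 // ler_wpM2r //.
  by move: E3; lra.
move: h1 h2; have : 0 <= n%:R * n%:R :> R by rewrite mulr_ge0.
rewrite exprMn !expr2; set j := max_level%:R; lra.
Qed.
End Sizes.

Lemma square_le_expR (R : realType) (L : R) : 12 * 60 ^+ 3 <= L -> 12 * L ^+ 2 <= expR (L / 20).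
Proof.
move=> hL; have L0 : 0 <= L by apply: le_trans hL; rewrite mulr_ge0 ?exprn_ge0.
have -> : L / 20 = 3%:R * (L / 60) by field.
rewrite expR_natM; apply: (@le_trans _ _ ((L / 60) ^+ 3)).
  have -> : (L / 60) ^+ 3 = L ^+ 2 * (L / 60 ^+ 3) by field.
  rewrite mulrC ler_wpM2l ?exprn_ge0 //.
  by rewrite ler_pdivlMr ?exprn_gt0.
rewrite lerXn2r ?nnegrE ?expR_ge0 ?divr_ge0 //.
by apply: le_trans (expR_ge1Dx _); rewrite lerDr.
Qed.

Lemma failure_eventually (R : realType) : exists2 C : R, 0 < C &
  forall eps : R, 0 < eps -> exists L0 : R, forall (T : finType) (e : rel T) (k n : nat) (L : R),
    simple_graph e -> bipartite e -> regular k e -> #|T| = (2 * n)%N ->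
    expR L = n%:R -> L0 <= L -> (C * n%:R) ^+ 2 <= k%:R ^+ 2 * L ->
    (count (fun s => hitting_time (@has_perfect_matching T) s != hitting_time (@no_isolated T) s)
       (processes e))%:R <= eps * (#|edges e|`!)%:R.
Proof.
pose E := (Num.truncn (3 * expR 1200 : R)).+1.
have E_ge : 3 * expR 1200 <= E%:R :> R by exact/ltW/truncnS_gt.
have E_ge3 : (3 <= E)%N.
  rewrite -(ler_nat R); apply: le_trans E_ge; have := expR_ge1Dx (1200 : R); lra.
exists (2000 * E%:R); first by rewrite mulr_gt0 ?ltr0n.
move=> eps eps0.
exists (400 + (10 * (10000 * (entropy E)%:R)) + 12 * 60 ^+ 3 + 100 * (41 * 1000 / eps)).
move=> T e k n L [e_sym e_irr'] [c e_bip] e_reg cardT expL hL dense.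
have e_irr : irreflexive e by move=> x; exact/negbTE.
have t1 : 0 <= 10 * (10000 * (entropy E)%:R) :> R by rewrite !mulr_ge0.
have t2 : 0 <= 12 * 60 ^+ 3 :> R by rewrite mulr_ge0 ?exprn_ge0.
have t3 : 0 <= 100 * (41 * 1000 / eps) by rewrite mulr_ge0 // divr_ge0 ?mulr_ge0 ?(ltW eps0).
have L_ge : 400 <= L by lra.
have L_ent : 10 * (10000 * (entropy E)%:R) <= L by lra.
have L_sq : 12 * 60 ^+ 3 <= L by lra.
have L_eps : 41 * 1000 / eps <= L / 100 by lra.
have n0 : 0 < n%:R :> R by rewrite -expL expR_gt0.
have kn : (k <= 2 * n)%N.
  have /card_gt0P[v _] : (0 < #|T|)%N by rewrite cardT muln_gt0 /= -(ltr0n R).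
  by rewrite -cardT -(e_reg v) max_card.
apply: (le_trans (@failure_count R T e k n E (max_level n L) L c _ e_sym e_irr e_reg e_bip cardT
   expL L_ge _ E_ge3 E_ge _ _ _ L_ent (square_le_expR L_sq) _ _ _)).
- exact: (dense_k_gt0 E_ge3 L_ge expL dense).
- exact: (dense_degree_linear E_ge3 L_ge expL dense).
- by rewrite cardT; exact: (max_level_errors E_ge3 L_ge expL kn dense).
- by apply: max_level_flips dense.
- by apply: max_level_gt.
- by apply: dense_degree dense.
- by apply: dense_sparsity dense.
- by apply: dense_sample dense _ cardT.
rewrite ler_wpM2r // expRN ler_pdivrMr ?expR_gt0 // [eps * _]mulrC -ler_pdivrMr //.
by apply: (le_trans L_eps); apply: le_trans (expR_ge1Dx _); rewrite lerDr.
Qed.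

From mathcomp Require Import Rstruct Rstruct_topology.
From Stdlib Require Import Rpower.
From Stdlib Require Lra.
Local Close Scope ring_scope.

Lemma Rpower_third_cube (x : R) : Rlt 0 x ->
  Rmult (Rmult (Rpower x (Rdiv 1 3)) (Rpower x (Rdiv 1 3))) (Rpower x (Rdiv 1 3)) = x.
Proof.
move=> x0; rewrite -!Rpower_plus -[RHS]Rpower_1 //; congr Rpower.
Lra.lra.
Qed.

Theorem theorem1p1 (k : nat -> nat)
  (hk : forall C : R, exists N : nat, forall n : nat, (N <= n)%N ->
          Rge (Rmult (INR (k n)) (Rpower (ln (INR n)) (Rdiv 1 3)))
              (Rmult C (INR n))) :
  forall eps : R, Rlt 0 eps ->
  exists N : nat, forall n : nat, (N <= n)%N ->
  forall e : rel 'I_(2 * n),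
    simple_graph e -> bipartite e -> regular (k n) e ->
    Rle (Rminus 1 eps) (prob_tauM_eq_tauI e).
Proof.
move=> eps /RltP eps0.
have [C /RltP C0 small] := failure_eventually R.
have [L0 {}small] := small eps eps0.
have [N1 hN1] := hk C.
pose N2 := (Num.truncn (expR (Num.max L0 1)%R)).+1.
exists (maxn N1 N2) => n; rewrite geq_max => /andP[n1 n2] e e_simple e_bip e_reg.
have {}hN1 := hN1 n n1.
have nL : (expR (Num.max L0 1) <= n%:R)%R.
  apply: ltW; apply: lt_le_trans (truncnS_gt _) _; by rewrite ler_nat.
have n0 : (0 < n%:R :> R)%R by apply: lt_le_trans (expR_gt0 _) nL.
pose L := ln (INR n).
have expL : expR L = n%:R%R.
  by rewrite -RexpE /L exp_ln ?INRE //; apply/RltP.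
have : (Num.max L0 1 <= L)%R by rewrite -ler_expR expL.
rewrite ge_max => /andP[L0L L1].
(* With [t] the cube root of [L], the hypothesis reads [C * n <= k * t]; since [t >= 1], squaring
   and [t ^ 2 <= t ^ 3 = L] suffice. *)
have dense : ((C * n%:R) ^+ 2 <= (k n)%:R ^+ 2 * L)%R.
  have Lpos : Rlt 0 L by apply/RltP; exact: lt_le_trans ltr01 L1.
  have := Rpower_third_cube Lpos; move/Rge_le/RleP: hN1; rewrite -/L !INRE !RmultE.
  set t := Rpower L _ => h t3.
  have {}t3 : (t ^+ 3 = L)%R by rewrite -t3 !exprSr expr0 mul1r.
  have t0 : (0 <= t)%R by apply/ltW/RltP; exact: exp_pos.
  have t1 : (1 <= t)%R.
    rewrite leNgt; apply/negP => t1; move: L1; rewrite -t3 leNgt; case/negP.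
    by rewrite exprn_ilt1.
  apply: (@le_trans _ _ (((k n)%:R * t) ^+ 2)%R).
    by rewrite lerXn2r ?nnegrE ?mulr_ge0 ?ler0n //; apply/ltW/RltP.
  by rewrite exprMn ler_wpM2l ?exprn_ge0 ?ler0n // -t3 [(t ^+ 3)%R]exprSr ler_peMr ?exprn_ge0.
have := small 'I_(2 * n) e (k n) n L e_simple e_bip e_reg (card_ord _) expL L0L dense.
set cf := count _ _ => hcf.
have m0 : (0 < (#|edges e|`!)%:R :> R)%R by rewrite ltr0n fact_gt0.
have sz : size (processes e) = #|edges e|`!.
  by rewrite /processes size_permutations ?enum_uniq // -cardE.
rewrite /prob_tauM_eq_tauI sz; set cg := count _ _.
have cgf : cg + cf = #|edges e|`!.
  by rewrite -sz -(count_predC (fun s => hitting_time (@has_perfect_matching _) s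
    == hitting_time (@no_isolated _) s)).
apply/RleP; rewrite !INRE RdivE RminusE ler_pdivlMr // mulrBl mul1r lerBlDr.
by apply: le_trans (lerD (lexx _) hcf); rewrite -natrD cgf.
Qed.
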